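(* Let $\Lambda$ be the graded $k$-algebra given by generators and relations in the context. Then the internal degree zero part of the first Hochschild cohomology $\operatorname{HH}^1(\Lambda)$ is isomorphic (as a Lie algebra) to $\mathfrak{gl}_3(k)$, and is spanned by the image of the grading derivation $\Delta$ together with the images of the derivations arising from the $\mathfrak{sl}_3(k)$-action on $\Lambda$.
   Context: Let $k$ be an algebraically closed field of characteristic $p>3$. Let $W=\{(p,0),(-p,p),(0,-p)\}$ and $-W=\{(-p,0),(p,-p),(0,p)\}$ in $\mathbb{Z}^2$. Let $\mathbb{K}=k e_\lambda\oplus k e_\gamma\oplus k e_\mu$ with $e_\lambda,e_\gamma,e_\mu$ orthogonal idempotents summing to $1$, and let $V$ be the 12-dimensional $\mathbb{K}$-bimodule with - $e_\lambda Ve_\gamma$ with basis $v_\alpha$ ($\alpha\in W$), $e_\gamma Ve_\lambda$ with basis $v_\alpha$ ($\alpha\in -W$), - $e_\mu Ve_\lambda$ with basis $w_\alpha$ ($\alpha\in W$), $e_\lambda Ve_\mu$ with basis $w_\alpha$ ($\alpha\in -W$), and all other $e_\sigma Ve_\tau=0$. Write $v_{i,j}=v_{(i,j)}$, $w_{i,j}=w_{(i,j)}$. Then $\Lambda=T_{\mathbb{K}}(V)/(R)$ where the relations are, for $\alpha,\beta\in -W$: - $v_\alpha v_{-\beta}=0$ for $\alpha\ne\beta$, and $v_\alpha v_{-\alpha}=v_\beta v_{-\beta}$ for all $\alpha,\beta$; - $w_{-\alpha}w_\beta=0$ for $\alpha\neq\beta$, and $w_{-\alpha}w_\alpha=w_{-\beta}w_\beta$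 for all $\alpha,\beta$; - $w_{-\alpha}v_{-\beta}+w_{-\beta}v_{-\alpha}=0$ for all $\alpha,\beta$; - $v_\alpha w_\beta+v_\beta w_\alpha=0$ for all $\alpha,\beta$; - $v_{-\alpha}v_\beta+w_\beta w_{-\alpha}=0$ for $\alpha\ne\beta$, and $v_{-\alpha}v_\alpha+w_\alpha w_{-\alpha}=v_{-\beta}v_\beta+w_\beta w_{-\beta}$ for all $\alpha,\beta$. ($\Lambda$ is the basic algebra of a non-semisimple singular block of the restricted enveloping algebra of $\mathfrak{sl}_3(k)$.) The $K$-grading on $\Lambda$ is the $\mathbb{Z}_{\ge0}$-grading with the $e_\alpha$ in degree $0$ and $V$ in degree $1$. The internal degree zero part of $\operatorname{HH}^1(\Lambda)$ is the Lie algebra of $k$-linear derivations of $\Lambda$ preserving the $K$-grading modulo the inner derivations preserving it. $\Delta$ is the derivation with $\Delta(l)=nl$ for $l\in\Lambda_n$. The $\mathfrak{sl}_3(k)$-action: $e_\lambda Ve_\gamma$ is identified with the natural module $k^3$ so that $v_{p,0},-v_{-p,p},v_{0,-p}$ is the standard basis, and $e_\gamma Ve_\lambda$ with its dual so that $v_{-p,0},-v_{p,-p},v_{0,p}$ is the dual basis; similarly $e_\mu Ve_\lambda$ and $e_\lambda Ve_\mu$ are identified with the natural module and its dual by replacing $v$ by $w$ throughout. The resulting action on $V$, extended by derivations with the $e_\alpha$ sent to $0$, preserves the relations and gives an action of $\mathfrak{sl}_3(k)$ on $\Lambda$ by derivations. *)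

(* Defs.v *)
From HB Require Import structures.
From mathcomp Require Import all_boot all_order all_algebra.
From mathcomp Require Import finmap monalg boolp functions.

Set Implicit Arguments.
Unset Strict Implicit.
Unset Printing Implicit Defensive.

Import GRing.Theory.

Local Open Scope ring_scope.
Local Open Scope quotient_scope.

Record submodule (k : pzRingType) (V : lmodType k) := Submodule {
  submod_mem :> V -> Prop;
  submod0 : submod_mem 0;
  submodD : forall x y, submod_mem x -> submod_mem y -> submod_mem (x + y);
  submodZ : forall a x, submod_mem x -> submod_mem (a *: x)
}.

Section LQuotient.
Variables (k : pzRingType) (V : lmodType k) (I : submodule V).

Lemma submodN x : I x -> I (- x).
Proof. by rewrite -scaleN1r; apply: submodZ. Qed.

Lemma submodBC x y : I (x - y) -> I (y - x).
Proof. by rewrite -[y - x]opprB; apply: submodN. Qed.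

Definition lequiv (x y : V) := `[< I (x - y) >].

Lemma lequiv_is_equiv : equiv_class_of lequiv.
Proof.
split=> [x|x y|y x z]; rewrite /lequiv.
- by apply/asboolP; rewrite subrr; apply: submod0.
- by apply/asboolP/asboolP; apply: submodBC.
- move=> /asboolP hxy /asboolP hyz; apply/asboolP.
  by rewrite -[x](subrK y) -addrA; apply: submodD.
Qed.

Canonical lequiv_equiv := EquivRelPack lequiv_is_equiv.
Canonical lequiv_encModRel := defaultEncModRel lequiv.

Definition lquot := {eq_quot lequiv}.

HB.instance Definition _ := Choice.on lquot.

Definition lclass (x : V) : lquot := \pi_lquot x.
Definition lrepr (x : lquot) : V := repr x.

Lemma lreprK : cancel lrepr lclass.
Proof. exact: reprK. Qed.

Lemma lclassP x y : lclass x = lclass y <-> I (x - y).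
Proof.
split=> [/eqmodP|h]; first by move/asboolP.
by apply/eqmodP; apply/asboolP.
Qed.

Lemma lreprP x : I (lrepr (lclass x) - x).
Proof. by apply/lclassP; rewrite lreprK. Qed.

Definition lquot_opp (x : lquot) : lquot := lclass (- lrepr x).
Definition lquot_add (x y : lquot) : lquot := lclass (lrepr x + lrepr y).

Lemma lquot_oppE x : lquot_opp (lclass x) = lclass (- x).
Proof. by apply/lclassP; rewrite -opprD; apply/submodN/lreprP. Qed.

Lemma lquot_addE x y : lquot_add (lclass x) (lclass y) = lclass (x + y).
Proof.
by apply/lclassP; rewrite opprD addrACA; apply: submodD; apply: lreprP.
Qed.

Lemma lquot_addA : associative lquot_add.
Proof.
by move=> x y z; rewrite -[x]lreprK -[y]lreprK -[z]lreprK !lquot_addE addrA.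
Qed.

Lemma lquot_addC : commutative lquot_add.
Proof. by move=> x y; rewrite -[x]lreprK -[y]lreprK !lquot_addE addrC. Qed.

Lemma lquot_add0 : left_id (lclass 0) lquot_add.
Proof. by move=> x; rewrite -[x]lreprK lquot_addE add0r. Qed.

Lemma lquot_addN : left_inverse (lclass 0) lquot_opp lquot_add.
Proof. by move=> x; rewrite -[x]lreprK lquot_oppE lquot_addE addNr. Qed.

HB.instance Definition _ := GRing.isZmodule.Build lquot
  lquot_addA lquot_addC lquot_add0 lquot_addN.

Lemma lclassD x y : lclass (x + y) = lclass x + lclass y.
Proof. by rewrite -lquot_addE. Qed.

Definition lquot_scale (c : k) (x : lquot) : lquot := lclass (c *: lrepr x).

Lemma lquot_scaleE c x : lquot_scale c (lclass x) = lclass (c *: x).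
Proof. by apply/lclassP; rewrite -scalerBr; apply/submodZ/lreprP. Qed.

Lemma lquot_scaleA a b x : lquot_scale a (lquot_scale b x) = lquot_scale (a * b) x.
Proof. by rewrite -[x]lreprK !lquot_scaleE scalerA. Qed.

Lemma lquot_scale1 : left_id 1 lquot_scale.
Proof. by move=> x; rewrite -[x]lreprK !lquot_scaleE scale1r. Qed.

Lemma lquot_scaleDr : right_distributive lquot_scale +%R.
Proof.
move=> a x y; rewrite -[x]lreprK -[y]lreprK.
by rewrite -lclassD !lquot_scaleE scalerDr lclassD.
Qed.

Lemma lquot_scaleDl x : {morph lquot_scale^~ x : a b / a + b}.
Proof. by move=> a b; rewrite -[x]lreprK !lquot_scaleE scalerDl lclassD. Qed.

HB.instance Definition _ := GRing.Zmodule_isLmodule.Build k lquot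
  lquot_scaleA lquot_scale1 lquot_scaleDr lquot_scaleDl.

Lemma lclass_is_linear : linear lclass.
Proof. by move=> a x y; rewrite lclassD -lquot_scaleE. Qed.

HB.instance Definition _ := GRing.isLinear.Build k V lquot _ lclass lclass_is_linear.

End LQuotient.

Section AlgQuotient.
Variables (k : pzRingType) (A : algType k).

Inductive ideal_gen (R : A -> Prop) : A -> Prop :=
| IdealGen0 : ideal_gen R 0
| IdealGenD x y : ideal_gen R x -> ideal_gen R y -> ideal_gen R (x + y)
| IdealGenM a r b : R r -> ideal_gen R (a * r * b).

Variable R : A -> Prop.

Lemma ideal_genMl a x : ideal_gen R x -> ideal_gen R (a * x).
Proof.
elim=> [|y z _ hy _ hz|c r b hr]; first by rewrite mulr0; constructor.
  by rewrite mulrDr; constructor.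
by rewrite !mulrA; constructor.
Qed.

Lemma ideal_genMr b x : ideal_gen R x -> ideal_gen R (x * b).
Proof.
elim=> [|y z _ hy _ hz|a r c hr]; first by rewrite mul0r; constructor.
  by rewrite mulrDl; constructor.
by rewrite -!mulrA mulrA; constructor.
Qed.

Lemma ideal_genZ a x : ideal_gen R x -> ideal_gen R (a *: x).
Proof.
by have -> : a *: x = a%:A * x; [rewrite -scalerAl mul1r|apply: ideal_genMl].
Qed.

Definition ideal : submodule A :=
  Submodule (@IdealGen0 R) (@IdealGenD R) ideal_genZ.

Hypothesis proper : ~ ideal_gen R 1.

(* [proper] is an argument because [algType] requires [1 != 0]. *)
Definition alg_quot of (~ ideal_gen R 1) := lquot ideal.

Local Notation Q := (alg_quot proper).

HB.instance Definition _ := GRing.Lmodule.on Q.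

Definition qclass (x : A) : Q := lclass ideal x.
Definition qrepr (x : Q) : A := lrepr x.

Lemma qreprK : cancel qrepr qclass.
Proof. exact: lreprK. Qed.

Lemma qclassP x y : qclass x = qclass y <-> ideal_gen R (x - y).
Proof. exact: lclassP. Qed.

Lemma qclass_is_linear : linear qclass.
Proof. exact: lclass_is_linear. Qed.

HB.instance Definition _ := GRing.isLinear.Build k A Q _ qclass qclass_is_linear.

Lemma qclassD x y : qclass (x + y) = qclass x + qclass y.
Proof. exact: lclassD. Qed.

Lemma qclassZ a x : qclass (a *: x) = a *: qclass x.
Proof. exact: linearZ. Qed.

Definition qmul (x y : Q) : Q := qclass (qrepr x * qrepr y).

Lemma qmulE x y : qmul (qclass x) (qclass y) = qclass (x * y).
Proof.
set x' := qrepr (qclass x); set y' := qrepr (qclass y).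
have hx : ideal_gen R (x' - x) by apply/qclassP; rewrite qreprK.
have hy : ideal_gen R (y' - y) by apply/qclassP; rewrite qreprK.
apply/qclassP; have -> : x' * y' - x * y = (x' - x) * y' + x * (y' - y).
  by rewrite mulrBl mulrBr addrA subrK.
by constructor; [apply: ideal_genMr|apply: ideal_genMl].
Qed.

Lemma qmulA : associative qmul.
Proof.
by move=> x y z; rewrite -[x]qreprK -[y]qreprK -[z]qreprK !qmulE mulrA.
Qed.

Lemma qmul1q : left_id (qclass 1) qmul.
Proof. by move=> x; rewrite -[x]qreprK qmulE mul1r. Qed.

Lemma qmulq1 : right_id (qclass 1) qmul.
Proof. by move=> x; rewrite -[x]qreprK qmulE mulr1. Qed.

Lemma qmulDl : left_distributive qmul +%R.
Proof.
move=> x y z; rewrite -[x]qreprK -[y]qreprK -[z]qreprK.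
by rewrite -qclassD !qmulE -qclassD mulrDl.
Qed.

Lemma qmulDr : right_distributive qmul +%R.
Proof.
move=> x y z; rewrite -[x]qreprK -[y]qreprK -[z]qreprK.
by rewrite -qclassD !qmulE -qclassD mulrDr.
Qed.

Lemma qone_neq0 : qclass 1 != 0.
Proof.
by apply/eqP; rewrite -(linear0 qclass) => /qclassP; rewrite subr0.
Qed.

HB.instance Definition _ := GRing.Zmodule_isNzRing.Build Q
  qmulA qmul1q qmulq1 qmulDl qmulDr qone_neq0.

Lemma qclassM x y : qclass (x * y) = qclass x * qclass y.
Proof. by rewrite -qmulE. Qed.

Lemma qscaleAl (a : k) (x y : Q) : a *: (x * y) = a *: x * y.
Proof.
rewrite -[x]qreprK -[y]qreprK -qclassZ.
by rewrite -!qclassM -qclassZ scalerAl.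
Qed.

Lemma qscaleAr (a : k) (x y : Q) : a *: (x * y) = x * (a *: y).
Proof.
rewrite -[x]qreprK -[y]qreprK -qclassZ.
by rewrite -!qclassM -qclassZ scalerAr.
Qed.

HB.instance Definition _ := GRing.Lmodule_isLalgebra.Build k Q qscaleAl.
HB.instance Definition _ := GRing.Lalgebra_isAlgebra.Build k Q qscaleAr.

Lemma qclass_is_monoid_morphism : monoid_morphism qclass.
Proof. by split=> // x y; rewrite qclassM. Qed.

HB.instance Definition _ := GRing.isMonoidMorphism.Build A Q qclass
  qclass_is_monoid_morphism.

End AlgQuotient.

HB.mixin Record Lmodule_isLie (k : comPzRingType) L of GRing.Lmodule k L := {
  lie : L -> L -> L;
  lie_linearl : forall y, linear (lie ^~ y);
  lie_linearr : forall x, linear (lie x);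
  liexx : forall x, lie x x = 0;
  lie_jacobi : forall x y z,
    lie x (lie y z) + lie y (lie z x) + lie z (lie x y) = 0
}.

#[short(type="lieAlgType")]
HB.structure Definition LieAlgebra (k : comPzRingType) :=
  {L of GRing.Lmodule k L & Lmodule_isLie k L}.

Section LieTheory.
Variables (k : comPzRingType) (L : lieAlgType k).
Implicit Types x y z : L.

Lemma lieBr x y z : lie x (y - z) = lie x y - lie x z.
Proof.
by rewrite addrC -scaleN1r lie_linearr scaleN1r addrC.
Qed.

Lemma lieDr x y z : lie x (y + z) = lie x y + lie x z.
Proof. by rewrite -[y]scale1r lie_linearr !scale1r. Qed.

Lemma lieDl x y z : lie (y + z) x = lie y x + lie z x.
Proof. by rewrite -[y]scale1r lie_linearl !scale1r. Qed.

Lemma lieC x y : lie x y = - lie y x.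
Proof.
apply/eqP; rewrite -addr_eq0; apply/eqP.
by have := liexx (x + y); rewrite lieDl !lieDr !liexx add0r addr0.
Qed.

End LieTheory.

Definition lie_morphism (k : comPzRingType) (L M : lieAlgType k)
  (f : L -> M) : Prop := forall x y, f (lie x y) = lie (f x) (f y).

Definition lie_isomorphic (k : comPzRingType) (L M : lieAlgType k) : Prop :=
  exists f : {linear L -> M}, bijective f /\ lie_morphism f.

Definition spans (k : pzRingType) (V : lmodType k) (S : V -> Prop) : Prop :=
  forall x, exists2 s : seq (k * V),
    (forall c, c \in s -> S c.2) & x = \sum_(c <- s) c.1 *: c.2.

Lemma jacobi_cancel (V : zmodType) (a b c d e f : V) :
  a - b - (c - f) + (c - d - (e - b)) + (e - f - (a - d)) = 0.
Proof.
rewrite !opprB !addrA.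
rewrite (ACl ((1*12)*(2*7)*(3*10)*(4*5)*(6*11)*(8*9))) /=.
by rewrite !(subrr, addNr) !addr0.
Qed.

Section GeneralLinear.
Variables (k : comPzRingType) (n : nat).

Definition gl := 'M[k]_n.

HB.instance Definition _ := GRing.Lmodule.on gl.

Definition gl_lie (A B : gl) : gl := A *m B - B *m A.

Lemma gl_lie_linearl B : linear (gl_lie ^~ B).
Proof.
move=> a x y; rewrite /gl_lie mulmxDl mulmxDr -scalemxAl -scalemxAr scalerBr.
by rewrite opprD addrACA.
Qed.

Lemma gl_lie_linearr A : linear (gl_lie A).
Proof.
move=> a x y; rewrite /gl_lie mulmxDl mulmxDr -scalemxAl -scalemxAr scalerBr.
by rewrite opprD addrACA.
Qed.

Lemma gl_liexx A : gl_lie A A = 0.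
Proof. exact: subrr. Qed.

Lemma gl_lie_jacobi A B C :
  gl_lie A (gl_lie B C) + gl_lie B (gl_lie C A) + gl_lie C (gl_lie A B) = 0.
Proof.
by rewrite /gl_lie !(mulmxBl, mulmxBr) !mulmxA jacobi_cancel.
Qed.

HB.instance Definition _ := Lmodule_isLie.Build k gl
  gl_lie_linearl gl_lie_linearr gl_liexx gl_lie_jacobi.

End GeneralLinear.

Section GradedDerivations.
Variables (k : fieldType) (A : algType k) (gr : nat -> submodule A).

Definition is_der0 (D : A -> A) : Prop :=
  [/\ linear D,
      forall x y, D (x * y) = D x * y + x * D y
    & forall n x, gr n x -> gr n (D x)].

Definition der0_pred : {pred A -> A} := fun D => `[< is_der0 D >].

Lemma der0_predP D : D \in der0_pred <-> is_der0 D.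
Proof. by rewrite unfold_in; split => /asboolP. Qed.

Lemma fctDE (D E : A -> A) x : (D + E) x = D x + E x.
Proof. by []. Qed.

Lemma fctZE c (D : A -> A) x : (c *: D) x = c *: D x.
Proof. by []. Qed.

Lemma fct0E x : (0 : A -> A) x = 0.
Proof. by []. Qed.

Lemma der0_submod : subsemimod_closed der0_pred.
Proof.
split; first split.
- apply/der0_predP; split=> [a x y|x y|n x _]; rewrite !fct0E.
  + by rewrite scaler0 addr0.
  + by rewrite mul0r mulr0 addr0.
  + exact: submod0.
- move=> D E /der0_predP[Dl DM Dh] /der0_predP[El EM Eh]; apply/der0_predP.
  split=> [a x y|x y|n x hx]; rewrite !fctDE.
  + by rewrite Dl El scalerDr addrACA.
  + by rewrite DM EM mulrDl mulrDr addrACA.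
  + by apply: submodD; [apply: Dh|apply: Eh].
- move=> c D /der0_predP[Dl DM Dh]; apply/der0_predP.
  split=> [a x y|x y|n x hx]; rewrite !fctZE.
  + by rewrite Dl scalerDr !scalerA mulrC.
  + by rewrite DM scalerDr scalerAl scalerAr.
  + by apply: submodZ; apply: Dh.
Qed.

HB.instance Definition _ := GRing.isSubmodClosed.Build k (A -> A)
  der0_pred der0_submod.

Record der0 := Der0 { der0_val :> A -> A; _ : der0_val \in der0_pred }.

HB.instance Definition _ := [isSub for der0_val].
HB.instance Definition _ := [Choice of der0 by <:].
HB.instance Definition _ := [SubChoice_isSubLmodule of der0 by <:].

Lemma der0P (D : der0) : is_der0 D.
Proof. by apply/der0_predP; case: D. Qed.

Lemma der0_eq (D E : der0) : D =1 E -> D = E.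
Proof. by move=> DE; apply/val_inj/funext. Qed.

Lemma der0D (D E : der0) x : (D + E) x = D x + E x.
Proof. by []. Qed.

Lemma der0Z c (D : der0) x : (c *: D) x = c *: D x.
Proof. by []. Qed.

Lemma der0_linear (D : der0) : linear D.
Proof. by case: (der0P D). Qed.

Lemma der0M (D : der0) x y : D (x * y) = D x * y + x * D y.
Proof. by case: (der0P D). Qed.

Lemma der0_homog (D : der0) n x : gr n x -> gr n (D x).
Proof. by case: (der0P D) => _ _; apply. Qed.

HB.instance Definition _ (D : der0) :=
  GRing.isLinear.Build k A A _ D (der0_linear D).

Lemma der0B (D : der0) x y : D (x - y) = D x - D y.
Proof. exact: linearB. Qed.

Lemma der0_lie_subproof (D E : der0) :
  (fun x => D (E x) - E (D x)) \in der0_pred.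
Proof.
apply/der0_predP; split=> [a x y|x y|n x hx].
- by rewrite !der0_linear scalerBr opprD addrACA.
- rewrite (der0M E) (der0M D) !linearD /= !der0M mulrBl mulrBr !opprD !addrA.
  rewrite (ACl ((1*5*4*8)*(2*7)*(3*6))) /=.
  by rewrite !subrr addr0 addr0.
- rewrite -scaleN1r; apply: submodD; last apply: submodZ.
    by do 2!apply: der0_homog.
  by do 2!apply: der0_homog.
Qed.

Definition der0_lie (D E : der0) : der0 := Der0 (der0_lie_subproof D E).

Lemma der0_lieE D E x : der0_lie D E x = D (E x) - E (D x).
Proof. by []. Qed.

Lemma der0_lie_linearl E : linear (der0_lie ^~ E).
Proof.
move=> a D F /=; apply: der0_eq => x.
rewrite !(der0D, der0Z, der0_lieE) der0_linear.
by rewrite scalerBr opprD addrACA.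
Qed.

Lemma der0_lie_linearr D : linear (der0_lie D).
Proof.
move=> a E F /=; apply: der0_eq => x.
rewrite !(der0D, der0Z, der0_lieE) der0_linear.
by rewrite scalerBr opprD addrACA.
Qed.

Lemma der0_liexx D : der0_lie D D = 0.
Proof. by apply: der0_eq => x; rewrite der0_lieE subrr. Qed.

Lemma der0_lie_jacobi D E F :
  der0_lie D (der0_lie E F) + der0_lie E (der0_lie F D)
  + der0_lie F (der0_lie D E) = 0.
Proof.
by apply: der0_eq => x; rewrite !der0D !der0_lieE !der0B jacobi_cancel.
Qed.

HB.instance Definition _ := Lmodule_isLie.Build k der0
  der0_lie_linearl der0_lie_linearr der0_liexx der0_lie_jacobi.

Definition is_inner (D : der0) : Prop :=
  exists a : A, forall x, D x = a * x - x * a.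

Lemma is_inner0 : is_inner 0.
Proof. by exists 0 => x; rewrite mul0r mulr0 subrr. Qed.

Lemma is_innerD D E : is_inner D -> is_inner E -> is_inner (D + E).
Proof.
move=> [a ha] [b hb]; exists (a + b) => x.
by rewrite der0D ha hb mulrDl mulrDr opprD addrACA.
Qed.

Lemma is_innerZ c D : is_inner D -> is_inner (c *: D).
Proof.
move=> [a ha]; exists (c *: a) => x.
by rewrite der0Z ha scalerBr scalerAl scalerAr.
Qed.

Definition inner : submodule der0 := Submodule is_inner0 is_innerD is_innerZ.

Lemma inner_lier D E : is_inner E -> is_inner (lie D E).
Proof.
move=> [a ha]; exists (D a) => x.
rewrite [LHS]der0_lieE !ha der0B !der0M opprB opprD !addrA.
by rewrite (ACl ((1*4)*(2*6)*(3*5))) /= subrr addNr !addr0.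
Qed.

Definition HH1_0 := lquot inner.

HB.instance Definition _ := GRing.Lmodule.on HH1_0.

Definition HH1_class (D : der0) : HH1_0 := lclass inner D.

Lemma HH1_classP D E : HH1_class D = HH1_class E <-> is_inner (D - E).
Proof. exact: lclassP. Qed.

Lemma HH1_class_is_linear : linear HH1_class.
Proof. exact: lclass_is_linear. Qed.

HB.instance Definition _ :=
  GRing.isLinear.Build k der0 HH1_0 _ HH1_class HH1_class_is_linear.

Lemma HH1_classD D E : HH1_class (D + E) = HH1_class D + HH1_class E.
Proof. exact: linearD. Qed.

Definition HH1_repr (x : HH1_0) : der0 := lrepr x.

Lemma HH1_reprK : cancel HH1_repr HH1_class.
Proof. exact: lreprK. Qed.

Definition HH1_lie (x y : HH1_0) : HH1_0 :=
  HH1_class (lie (HH1_repr x) (HH1_repr y)).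

Lemma HH1_lieE D E : HH1_lie (HH1_class D) (HH1_class E) = HH1_class (lie D E).
Proof.
set D' := HH1_repr (HH1_class D); set E' := HH1_repr (HH1_class E).
have hD : is_inner (D' - D) by apply/HH1_classP; rewrite HH1_reprK.
have hE : is_inner (E' - E) by apply/HH1_classP; rewrite HH1_reprK.
apply/HH1_classP.
have -> : lie D' E' - lie D E = lie D' (E' - E) - lie E (D' - D).
  by rewrite !lieBr (lieC E D') (lieC E D) opprD !opprK addrA subrK.
apply: (submodD (s := inner)); first exact: inner_lier.
by apply: (submodN (I := inner)); apply: inner_lier.
Qed.

Lemma HH1_lie_linearl y : linear (HH1_lie ^~ y).
Proof.
move=> a x z; rewrite -[x]HH1_reprK -[y]HH1_reprK -[z]HH1_reprK -linearP.
by rewrite !HH1_lieE lie_linearl linearP.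
Qed.

Lemma HH1_lie_linearr x : linear (HH1_lie x).
Proof.
move=> a y z; rewrite -[x]HH1_reprK -[y]HH1_reprK -[z]HH1_reprK -linearP.
by rewrite !HH1_lieE lie_linearr linearP.
Qed.

Lemma HH1_liexx x : HH1_lie x x = 0.
Proof. by rewrite -[x]HH1_reprK HH1_lieE liexx linear0. Qed.

Lemma HH1_lie_jacobi x y z :
  HH1_lie x (HH1_lie y z) + HH1_lie y (HH1_lie z x)
  + HH1_lie z (HH1_lie x y) = 0.
Proof.
rewrite -[x]HH1_reprK -[y]HH1_reprK -[z]HH1_reprK !HH1_lieE.
by rewrite -!HH1_classD lie_jacobi linear0.
Qed.

HB.instance Definition _ := Lmodule_isLie.Build k HH1_0
  HH1_lie_linearl HH1_lie_linearr HH1_liexx HH1_lie_jacobi.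

Definition is_grading_der (D : der0) : Prop :=
  forall n l, gr n l -> D l = n%:R *: l.

End GradedDerivations.

Inductive vertex := pt_lambda | pt_gamma | pt_mu.

Definition vertex_to_ord (x : vertex) : 'I_3 :=
  match x with pt_lambda => inord 0 | pt_gamma => inord 1 | pt_mu => inord 2 end.

Definition vertex_of_ord (i : 'I_3) : vertex :=
  match val i with 0 => pt_lambda | 1 => pt_gamma | _ => pt_mu end.

Lemma vertex_to_ordK : cancel vertex_to_ord vertex_of_ord.
Proof. by case; rewrite /vertex_of_ord /= inordK. Qed.

HB.instance Definition _ := Finite.copy vertex (can_type vertex_to_ordK).

(* With [W = {W_0, W_1, W_2}], [W_0 = (p, 0)], [W_1 = (-p, p)] and
   [W_2 = (0, -p)], the arrows [Vpos i], [Vneg i], [Wpos i], [Wneg i] are the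
   basis vectors of [V] written [v_(W_i)], [v_(- W_i)], [w_(W_i)], [w_(- W_i)].
   The pairs of integers serve only as labels. *)
Inductive arrow :=
  Vpos of 'I_3 | Vneg of 'I_3 | Wpos of 'I_3 | Wneg of 'I_3.

Definition arrow_to (a : arrow) : bool * bool * 'I_3 :=
  match a with
  | Vpos i => (true, true, i) | Vneg i => (true, false, i)
  | Wpos i => (false, true, i) | Wneg i => (false, false, i)
  end.

Definition arrow_of (c : bool * bool * 'I_3) : arrow :=
  match c with
  | (true, true, i) => Vpos i | (true, false, i) => Vneg i
  | (false, true, i) => Wpos i | (false, false, i) => Wneg i
  end.

Lemma arrow_toK : cancel arrow_to arrow_of.
Proof. by case. Qed.

HB.instance Definition _ := Finite.copy arrow (can_type arrow_toK).

(* The arrow [a] lies in [e_(src a) V e_(tgt a)]: paths are read from left to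
   right, in the order of multiplication. *)
Definition src (a : arrow) : vertex :=
  match a with
  | Vpos _ => pt_lambda | Vneg _ => pt_gamma | Wpos _ => pt_mu | Wneg _ => pt_lambda
  end.

Definition tgt (a : arrow) : vertex :=
  match a with
  | Vpos _ => pt_gamma | Vneg _ => pt_lambda | Wpos _ => pt_lambda | Wneg _ => pt_mu
  end.

Fixpoint composable (x : vertex) (s : seq arrow) : bool :=
  if s is a :: s' then (src a == x) && composable (tgt a) s' else true.

Definition endpoint (x : vertex) (s : seq arrow) : vertex :=
  last x (map tgt s).

Definition qpath := {q : vertex * seq arrow | composable q.1 q.2}.

HB.instance Definition _ := SubChoice.on qpath.

Definition pstart (q : qpath) : vertex := (val q).1.
Definition parrows (q : qpath) : seq arrow := (val q).2.
Definition pend (q : qpath) : vertex := endpoint (pstart q) (parrows q).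
Definition plength (q : qpath) : nat := size (parrows q).

Lemma composable_cat x s t :
  composable x (s ++ t) = composable x s && composable (endpoint x s) t.
Proof. by elim: s x => //= a s IHs x; rewrite IHs andbA. Qed.

Lemma endpoint_cat x s t : endpoint x (s ++ t) = endpoint (endpoint x s) t.
Proof. by rewrite /endpoint map_cat last_cat. Qed.

Lemma qpathP (x y : qpath) :
  pstart x = pstart y -> parrows x = parrows y -> x = y.
Proof.
by case: x y => [[x s] hx] [[y t] hy]; rewrite /pstart /parrows /= => e1 e2;
  apply/val_inj; rewrite /= e1 e2.
Qed.

Definition ptriv (x : vertex) : qpath := exist _ (x, [::]) isT.

Lemma parrow_subproof a : composable (src a) [:: a].
Proof. by rewrite /= eqxx. Qed.

Definition parrow (a : arrow) : qpath :=
  exist _ (src a, [:: a]) (parrow_subproof a).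

Definition pcomp (x y : qpath) : option qpath :=
  if pend x == pstart y then insub (pstart x, parrows x ++ parrows y)
  else None.

Variant pcomp_spec (x y : qpath) : option qpath -> Prop :=
| PcompSome z of pend x = pstart y & pstart z = pstart x & pend z = pend y
    & parrows z = parrows x ++ parrows y : pcomp_spec x y (Some z)
| PcompNone of pend x <> pstart y : pcomp_spec x y None.

Lemma pcompP x y : pcomp_spec x y (pcomp x y).
Proof.
rewrite /pcomp; case: eqP => [exy|]; last by constructor.
case: insubP => [z _ zE|/negP[]].
  by constructor=> //; rewrite /pend /pstart /parrows zE //= endpoint_cat -/(pend x) exy.
rewrite /= composable_cat (valP x : composable (pstart x) (parrows x)) /=.
by rewrite -/(pend x) exy; exact: (valP y).
Qed.

Lemma pcompA x y z : obind (pcomp x) (pcomp y z) = obind (pcomp^~ z) (pcomp x y).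
Proof.
case: (pcompP x y) => [u exy su eu au|nxy] /=; case: (pcompP y z) => [w eyz sw ew aw|nyz] //=.
- case: (pcompP x w) => [r _ sr _ ar|]; last by rewrite sw.
  case: (pcompP u z) => [r' _ sr' _ ar'|]; last by rewrite eu.
  congr Some; apply: qpathP; first by rewrite sr sr' su.
  by rewrite ar ar' au aw catA.
- by case: (pcompP u z) => // r; rewrite eu.
- by case: (pcompP x w) => // r; rewrite sw.
Qed.

Lemma pcomp_trivl x y : pcomp (ptriv x) y = if x == pstart y then Some y else None.
Proof.
case: pcompP => [z exy sz _ az|/eqP]; last by move/negPf => /= ->.
have -> : x = pstart y := exy; rewrite eqxx; congr Some.
by apply: qpathP; rewrite ?sz ?az.
Qed.

Lemma pcomp_trivr x y : pcomp x (ptriv y) = if y == pend x then Some x else None.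
Proof.
case: pcompP => [z exy sz _ az|/eqP]; last by rewrite eq_sym => /negPf /= ->.
have -> : y = pend x := esym exy; rewrite eqxx; congr Some.
by apply: qpathP; rewrite ?sz ?az ?cats0.
Qed.

(* The n-th tensor power of [V] over [K] has the paths of length [n] as a basis;
   the product of two paths is their concatenation if they are composable, and
   [0] otherwise. *)
Definition tensor_alg (k : fieldType) := {malg k[qpath]}.

(* Locked so that failed unifications do not compute with finite maps. *)
HB.lock Definition tbasis (k : fieldType) (x : qpath) : tensor_alg k := << x >>.

Section TensorAlgebra.
Variable k : fieldType.

HB.instance Definition _ := GRing.Lmodule.on (tensor_alg k).

Local Notation T := (tensor_alg k).
Local Notation tbasis := (tbasis k).

Implicit Types (f g h : T).

Lemma tbasis_coef x y : (tbasis x)@_y = (x == y)%:R.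
Proof. by rewrite tbasis.unlock mcoeffU. Qed.

Definition tone : T := \sum_(v : vertex) tbasis (ptriv v).

Definition tcomp (x y : qpath) : T := oapp tbasis 0 (pcomp x y).

Definition tmul f g : T :=
  \sum_(x <- msupp f) \sum_(y <- msupp g) (f@_x * g@_y) *: tcomp x y.

Lemma tmulw (d1 d2 : {fset qpath}) f g :
  (msupp f `<=` d1)%fset -> (msupp g `<=` d2)%fset ->
  tmul f g = \sum_(x <- d1) \sum_(y <- d2) (f@_x * g@_y) *: tcomp x y.
Proof.
move=> le1 le2; rewrite /tmul (big_fset_incl _ le1) /=.
  apply/eq_bigr=> x _; apply/big_fset_incl => // y _ /mcoeff_outdom ->.
  by rewrite mulr0 scale0r.
move=> x _ /mcoeff_outdom fx.
by rewrite big1 // => y _; rewrite fx mul0r scale0r.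
Qed.

Lemma tmulDl : left_distributive tmul +%R.
Proof.
move=> f1 f2 g.
rewrite (@tmulw (msupp f1 `|` msupp f2)%fset (msupp g) (f1 + f2)) ?msuppD_le //.
rewrite (@tmulw (msupp f1 `|` msupp f2)%fset (msupp g) f1) ?fsubsetUl //.
rewrite (@tmulw (msupp f1 `|` msupp f2)%fset (msupp g) f2) ?fsubsetUr //.
rewrite -big_split /=; apply/eq_bigr=> x _.
rewrite -big_split /=; apply/eq_bigr=> y _.
by rewrite mcoeffD mulrDl scalerDl.
Qed.

Lemma tmulDr : right_distributive tmul +%R.
Proof.
move=> f g1 g2.
rewrite (@tmulw (msupp f) (msupp g1 `|` msupp g2)%fset f (g1 + g2)) ?msuppD_le //.
rewrite (@tmulw (msupp f) (msupp g1 `|` msupp g2)%fset f g1) ?fsubsetUl //.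
rewrite (@tmulw (msupp f) (msupp g1 `|` msupp g2)%fset f g2) ?fsubsetUr //.
rewrite -big_split /=; apply/eq_bigr=> x _.
rewrite -big_split /=; apply/eq_bigr=> y _.
by rewrite mcoeffD mulrDr scalerDl.
Qed.

Lemma tmulZl c f g : tmul (c *: f) g = c *: tmul f g.
Proof.
rewrite (@tmulw (msupp f) (msupp g)) ?msuppZ_le // scaler_sumr.
apply/eq_bigr=> x _; rewrite scaler_sumr; apply/eq_bigr=> y _.
by rewrite mcoeffZ scalerA mulrA.
Qed.

Lemma tmulZr c f g : tmul f (c *: g) = c *: tmul f g.
Proof.
rewrite (@tmulw (msupp f) (msupp g)) ?msuppZ_le // scaler_sumr.
apply/eq_bigr=> x _; rewrite scaler_sumr; apply/eq_bigr=> y _.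
by rewrite mcoeffZ scalerA mulrCA mulrA.
Qed.

Lemma tmul0g g : tmul 0 g = 0.
Proof. by rewrite -[X in tmul X](scale0r 0) tmulZl scale0r. Qed.

Lemma tmulg0 g : tmul g 0 = 0.
Proof. by rewrite -[X in tmul _ X](scale0r 0) tmulZr scale0r. Qed.

Lemma tmul_suml I (r : seq I) (P : pred I) (F : I -> T) g :
  tmul (\sum_(i <- r | P i) F i) g = \sum_(i <- r | P i) tmul (F i) g.
Proof. exact: (big_morph (tmul^~ g) (fun x y => tmulDl x y g) (tmul0g g)). Qed.

Lemma tmul_sumr I (r : seq I) (P : pred I) (F : I -> T) g :
  tmul g (\sum_(i <- r | P i) F i) = \sum_(i <- r | P i) tmul g (F i).
Proof. exact: (big_morph (tmul g) (tmulDr g) (tmulg0 g)). Qed.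

Lemma tmul_basis x y : tmul (tbasis x) (tbasis y) = tcomp x y.
Proof.
have supp1 z : (msupp (tbasis z) `<=` [fset z])%fset.
  by rewrite tbasis.unlock msuppU_le.
rewrite (tmulw (supp1 x) (supp1 y)) !big_seq_fset1.
by rewrite !tbasis_coef !eqxx mulr1 scale1r.
Qed.

Lemma tbasisE f : f = \sum_(x <- msupp f) f@_x *: tbasis x.
Proof.
rewrite [LHS]monalgE; apply/eq_bigr => x _; apply/malgP => y.
by rewrite mcoeffZ tbasis_coef mcoeffU mulr_natr.
Qed.

Lemma tensor_ind (P : T -> Prop) :
  P 0 -> (forall f g, P f -> P g -> P (f + g)) ->
  (forall c x, P (c *: tbasis x)) -> forall f, P f.
Proof.
by move=> P0 PD PZ f; rewrite [f]tbasisE; apply: (big_ind P) => // x _; apply: PZ.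
Qed.

Lemma tmulA : associative tmul.
Proof.
move=> f g h; elim/tensor_ind: f => [|f1 f2 h1 h2|a x].
- by rewrite !tmul0g.
- by rewrite !tmulDl h1 h2.
elim/tensor_ind: g => [|g1 g2 h1 h2|b y].
- by rewrite !(tmul0g, tmulg0).
- by rewrite !(tmulDl, tmulDr) h1 h2.
elim/tensor_ind: h => [|f1 f2 h1 h2|c z].
- by rewrite !tmulg0.
- by rewrite !tmulDr h1 h2.
rewrite !(tmulZl, tmulZr) !tmul_basis !scalerA -[c * a * b]mulrA [c * _]mulrC.
apply: (congr1 ( *:%R (a * b * c))).
have := pcompA x y z; rewrite /tcomp.
case: (pcomp x y) => [u|] /=; case: (pcomp y z) => [w|] /=.
- by rewrite !tmul_basis /tcomp => ->.
- by rewrite tmul_basis /tcomp tmulg0 => <-.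
- by rewrite tmul_basis /tcomp tmul0g => ->.
- by rewrite tmulg0 tmul0g.
Qed.

Lemma tmul1g : left_id tone tmul.
Proof.
elim/tensor_ind => [|f g hf hg|c x]; first exact: tmulg0.
  by rewrite tmulDr hf hg.
rewrite tmulZr tmul_suml (bigD1 (pstart x)) //= big1 => [|v /negPf nv].
  by rewrite tmul_basis /tcomp pcomp_trivl eqxx addr0.
by rewrite tmul_basis /tcomp pcomp_trivl nv.
Qed.

Lemma tmulg1 : right_id tone tmul.
Proof.
elim/tensor_ind => [|f g hf hg|c x]; first exact: tmul0g.
  by rewrite tmulDl hf hg.
rewrite tmulZl tmul_sumr (bigD1 (pend x)) //= big1 => [|v /negPf nv].
  by rewrite tmul_basis /tcomp pcomp_trivr eqxx addr0.
by rewrite tmul_basis /tcomp pcomp_trivr nv.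
Qed.

Lemma tcoef_sum I (r : seq I) (P : pred I) (F : I -> T) x :
  (\sum_(i <- r | P i) F i)@_x = \sum_(i <- r | P i) (F i)@_x.
Proof. exact: (big_morph (mcoeff x) (mcoeffD x) (mcoeff0 x)). Qed.

Lemma tone_coef v : tone@_(ptriv v) = 1.
Proof.
rewrite tcoef_sum (bigD1 v) //= tbasis_coef eqxx big1 ?addr0 // => w nw.
rewrite tbasis_coef; case: eqP => // /(congr1 pstart) wv.
by case/eqP: nw.
Qed.

Lemma tone_neq0 : tone != 0.
Proof.
apply/eqP=> /(congr1 (mcoeff (ptriv pt_lambda))) /eqP.
by rewrite tone_coef mcoeff0 oner_eq0.
Qed.

HB.instance Definition _ := GRing.Zmodule_isNzRing.Build T
  tmulA tmul1g tmulg1 tmulDl tmulDr tone_neq0.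

HB.instance Definition _ := GRing.Lmodule_isLalgebra.Build k T
  (fun c f g => esym (tmulZl c f g)).

HB.instance Definition _ := GRing.Lalgebra_isAlgebra.Build k T
  (fun c f g => esym (tmulZr c f g)).

Definition tidem (v : vertex) : T := tbasis (ptriv v).
Definition tgen (a : arrow) : T := tbasis (parrow a).

Definition thomog (n : nat) (f : T) : Prop :=
  forall x, x \in msupp f -> plength x = n.

Lemma tmul_coef_triv f g v : (f * g)@_(ptriv v) = f@_(ptriv v) * g@_(ptriv v).
Proof.
have tcoef x y : (tcomp x y)@_(ptriv v) = ((x == ptriv v) && (y == ptriv v))%:R.
  rewrite /tcomp; case: (pcompP x y) => [z exy sz ez az|nxy] /=; last first.
    rewrite mcoeff0; case: eqP => [xv|_]; last by [].
    case: eqP => [yv|_]; last by [].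
    by case: nxy; rewrite xv yv.
  rewrite tbasis_coef; congr (nat_of_bool _)%:R.
  apply/eqP/idP => [zv|/andP[/eqP xv /eqP yv]]; last first.
    by apply: qpathP; rewrite ?sz ?az xv ?yv.
  have /esym/eqP := az; rewrite zv -size_eq0 size_cat addn_eq0 !size_eq0.
  case/andP=> /eqP ax /eqP ay.
  have xv : x = ptriv v by apply: qpathP; rewrite // -sz zv.
  rewrite xv eqxx; apply/eqP; apply: qpathP; last by [].
  by rewrite -exy xv.
have coefE h : h@_(ptriv v) = \sum_(x <- msupp h) h@_x * (x == ptriv v)%:R.
  rewrite [in LHS](tbasisE h) tcoef_sum; apply/eq_bigr => x _.
  by rewrite mcoeffZ tbasis_coef.
rewrite (coefE f) (coefE g) big_distrlr /= tcoef_sum; apply/eq_bigr => x _.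
rewrite tcoef_sum; apply/eq_bigr => y _.
by rewrite mcoeffZ tcoef mulrACA -mulnb natrM.
Qed.

End TensorAlgebra.

Section BlockAlgebra.
Variable k : fieldType.

Local Notation T := (tensor_alg k).
Local Notation v_pos i := (tgen k (Vpos i)).
Local Notation v_neg i := (tgen k (Vneg i)).
Local Notation w_pos i := (tgen k (Wpos i)).
Local Notation w_neg i := (tgen k (Wneg i)).

(* The relations for [alpha = - W_i] and [beta = - W_j]; an equality [x = y] is
   given as the element [x - y]. *)
Inductive relation : T -> Prop :=
| Rel_vv_ne i j of i != j : relation (v_neg i * v_pos j)
| Rel_vv_eq i j : relation (v_neg i * v_pos i - v_neg j * v_pos j)
| Rel_ww_ne i j of i != j : relation (w_pos i * w_neg j)
| Rel_ww_eq i j : relation (w_pos i * w_neg i - w_pos j * w_neg j)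
| Rel_wv i j : relation (w_pos i * v_pos j + w_pos j * v_pos i)
| Rel_vw i j : relation (v_neg i * w_neg j + v_neg j * w_neg i)
| Rel_vvww_ne i j of i != j : relation (v_pos i * v_neg j + w_neg j * w_pos i)
| Rel_vvww_eq i j :
    relation ((v_pos i * v_neg i + w_neg i * w_pos i)
              - (v_pos j * v_neg j + w_neg j * w_pos j)).

Lemma relation_coef_triv r u : relation r -> r@_(ptriv u) = 0.
Proof.
have gen0 a b : (tgen k a * tgen k b)@_(ptriv u) = 0.
  rewrite tmul_coef_triv tbasis_coef; case: eqP => [/(congr1 parrows)|] //.
  by rewrite mul0r.
by case=> [i j _|i j|i j _|i j|i j|i j|i j _|i j];
  rewrite !(mcoeffB, mcoeffD, gen0) ?addr0 ?subrr.
Qed.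

Lemma relation_proper : ~ ideal_gen relation 1.
Proof.
suff coef0 x : ideal_gen relation x -> x@_(ptriv pt_lambda) = 0.
  by move/coef0/eqP; rewrite tone_coef oner_eq0.
elim=> [|y z _ hy _ hz|a r b hr]; first exact: mcoeff0.
  by rewrite mcoeffD hy hz addr0.
by rewrite !tmul_coef_triv (relation_coef_triv _ hr) mulr0 mul0r.
Qed.

Definition Lambda := alg_quot relation_proper.

HB.instance Definition _ := GRing.Algebra.on Lambda.

Definition Lproj (t : T) : Lambda := qclass relation_proper t.

Definition Lidem (u : vertex) : Lambda := Lproj (tidem k u).
Definition Lgen (a : arrow) : Lambda := Lproj (tgen k a).

Definition Lhomog (n : nat) (l : Lambda) : Prop :=
  exists2 t : T, thomog n t & l = Lproj t.

Lemma Lproj0 : Lproj 0 = 0.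
Proof. exact: (linear0 (qclass relation_proper)). Qed.

Lemma LprojD x y : Lproj (x + y) = Lproj x + Lproj y.
Proof. exact: qclassD. Qed.

Lemma LprojZ a x : Lproj (a *: x) = a *: Lproj x.
Proof. exact: qclassZ. Qed.

Lemma LprojM x y : Lproj (x * y) = Lproj x * Lproj y.
Proof. exact: qclassM. Qed.

Lemma Lproj1 : Lproj 1 = 1.
Proof. by []. Qed.

Lemma Lhomog0 n : Lhomog n 0.
Proof.
by exists 0; [move=> x; rewrite msupp0|rewrite Lproj0].
Qed.

Lemma LhomogD n x y : Lhomog n x -> Lhomog n y -> Lhomog n (x + y).
Proof.
move=> [t ht ->] [u hu ->]; exists (t + u); last by rewrite LprojD.
move=> q /(fsubsetP (msuppD_le _ _)); rewrite in_fsetU => /orP[].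
  exact: ht.
exact: hu.
Qed.

Lemma LhomogZ n a x : Lhomog n x -> Lhomog n (a *: x).
Proof.
move=> [t ht ->]; exists (a *: t); last by rewrite LprojZ.
by move=> q /(fsubsetP (msuppZ_le _ _)); apply: ht.
Qed.

Definition Lgrading (n : nat) : submodule Lambda :=
  Submodule (Lhomog0 n) (@LhomogD n) (@LhomogZ n).

(* The standard basis [v_(p,0), - v_(-p,p), v_(0,-p)] of the natural module for
   [c = Vpos], its dual basis for [c = Vneg], and likewise for [w]. *)
Definition sgen (c : 'I_3 -> arrow) (i : 'I_3) : Lambda :=
  (-1) ^+ i *: Lgen (c i).

(* [X] maps the j-th standard basis vector to the sum of [X i j] times the i-th
   one, hence the j-th dual basis vector to minus the sum of [X j i] times the
   i-th one. A derivation is determined by its values on the generators. *)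
Definition is_sl3_der (X : 'M[k]_3) (D : der0 Lgrading) : Prop :=
  [/\ forall u, D (Lidem u) = 0,
      forall j, D (sgen Vpos j) = \sum_(i < 3) X i j *: sgen Vpos i,
      forall j, D (sgen Vneg j) = - \sum_(i < 3) X j i *: sgen Vneg i,
      forall j, D (sgen Wpos j) = \sum_(i < 3) X i j *: sgen Wpos i
    & forall j, D (sgen Wneg j) = - \sum_(i < 3) X j i *: sgen Wneg i].

End BlockAlgebra.

(* Main.v *)
From HB Require Import structures.
Require Import Defs.
From mathcomp Require Import all_boot all_order all_algebra.
From mathcomp Require Import finmap monalg boolp ring.

Set Implicit Arguments.
Unset Strict Implicit.
Unset Printing Implicit Defensive.

Import GRing.Theory.

Local Open Scope ring_scope.

(** Write [x_i, xi_i, y_i, eta_i] for the generators [Vpos i, Vneg i, Wpos i,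
    Wneg i] of [Lambda]. The relations say that [xi_i x_j] and [y_i eta_j] are
    [delta_ij] times an element independent of [i, j], that so is
    [x_i xi_j + eta_j y_i], and that [y_i x_j] and [xi_i eta_j] are alternating
    in [i, j]. Each of these conditions is invariant under [gl_3] acting on [x],
    [y] by the natural module and on [xi], [eta] by its dual, so every matrix
    [X] gives a derivation ([gl_der_exists]); so does the grading
    ([grading_der]). Both come from the same construction: a map on generators
    that respects sources and targets extends to the tensor algebra by the
    Leibniz rule, and it descends if it kills the relations modulo the ideal
    ([Lambda_der]).

    Conversely, a derivation [D] that preserves the grading vanishes on the
    idempotents, because the degree zero part of [Lambda] is commutative and
    [2] is invertible. It then preserves each space [e_u V e_v], so it is given
    by four matrices [A, B, C, E], on [x, xi, y, eta]. Applying [D] to the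
    relations and testing the result with linear functionals on the degree two
    part of [Lambda] ([Lambda_functional]) gives [der_structure]:
    [B = t - A^T] and [E = t - C^T] with the same scalar [t], and [A - C] is
    scalar. The functionals exist because all relations are sums of paths of
    length two, so that the part of the ideal in degree two is the span of the
    relations.

    Inner derivations of degree zero come from the idempotents and rescale the
    four spaces: they are the [D] with [A] and [C] scalar and [t = 0]
    ([inner_der_mx], [scalar_der_inner]). Hence [A] modulo scalars together with
    [t] is a complete invariant of the class of [D]. As [3] is invertible it can
    be recorded as the single matrix [A - tr(A)/3 + t], which is [der_gl D]. For
    a commutator of derivations [A] is the commutator of matrices and [t]
    vanishes, so [der_gl] induces an injective morphism of Lie algebras to
    [gl_3]. It takes the derivation of a traceless [X] to [X] and the grading
    derivation to [2], so it is onto, and its inverse expresses each class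
    through these derivations.

    The generators used by [is_sl3_der] are [(-1)^i] times those above. This
    conjugates the matrices by [diag(1, -1, 1)] ([sign_conj]) and leaves the
    argument unchanged. *)

(** * Linear functionals on the tensor algebra and on its quotient *)
Section LinearExtension.
Variables (k : fieldType) (M : lmodType k) (F : qpath -> M).
Implicit Types t : tensor_alg k.

Definition lext t : M := \sum_(x <- msupp t) t@_x *: F x.

Lemma lextw (d : {fset qpath}) t :
  (msupp t `<=` d)%fset -> lext t = \sum_(x <- d) t@_x *: F x.
Proof.
move=> le; rewrite /lext (big_fset_incl _ le) // => x _ /mcoeff_outdom ->.
by rewrite scale0r.
Qed.

Lemma lext_is_linear : linear lext.
Proof.
move=> a t u; pose d := (msupp t `|` msupp u)%fset.
rewrite (@lextw d t) ?fsubsetUl // (@lextw d u) ?fsubsetUr //.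
rewrite (@lextw d); last first.
  apply: (fsubset_trans (msuppD_le _ _)); apply: fsetSU.
  exact: msuppZ_le.
rewrite scaler_sumr -big_split /=; apply: eq_bigr => x _.
by rewrite mcoeffD mcoeffZ scalerDl scalerA.
Qed.

HB.instance Definition _ :=
  GRing.isLinear.Build k (tensor_alg k) M _ lext lext_is_linear.

Lemma lext_tbasis x : lext (tbasis k x) = F x.
Proof.
rewrite (@lextw [fset x]%fset); last by rewrite tbasis.unlock msuppU_le.
by rewrite big_seq_fset1 tbasis_coef eqxx scale1r.
Qed.

End LinearExtension.

Section Paths.
Variable k : fieldType.
Local Notation T := (tensor_alg k).
Local Notation tb := (tbasis k).

Lemma tbasisM x y : tb x * tb y = oapp tb 0 (Defs.pcomp x y).
Proof. exact: tmul_basis. Qed.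

Lemma tgen_tgen a b : tgt a = src b ->
  exists2 q, tgen k a * tgen k b = tb q & parrows q = [:: a; b].
Proof.
move=> e; rewrite /tgen tbasisM; case: pcompP => [z _ sz _ az|]; last by rewrite /pend /=.
by exists z.
Qed.

Lemma thomog0 n : thomog n (0 : T).
Proof. by move=> x; rewrite msupp0. Qed.

Lemma thomogD n (f g : T) : thomog n f -> thomog n g -> thomog n (f + g).
Proof.
move=> hf hg x /(fsubsetP (msuppD_le _ _)); rewrite in_fsetU => /orP[].
  exact: hf.
exact: hg.
Qed.

Lemma thomogZ n c (f : T) : thomog n f -> thomog n (c *: f).
Proof. by move=> hf x /(fsubsetP (msuppZ_le _ _)); apply: hf. Qed.

Lemma thomog_sum n I (r : seq I) (P : pred I) (G : I -> T) :
  (forall i, P i -> thomog n (G i)) -> thomog n (\sum_(i <- r | P i) G i).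
Proof. by move=> h; apply: big_ind => //; [exact: thomog0|exact: thomogD]. Qed.

Lemma thomog_tbasis x : thomog (plength x) (tb x).
Proof.
by move=> y; rewrite tbasis.unlock => /(fsubsetP msuppU_le) /fset1P ->.
Qed.

Lemma thomogM m n (f g : T) : thomog m f -> thomog n g -> thomog (m + n) (f * g).
Proof.
move=> hf hg; rewrite [f]tbasisE mulr_suml big_seq; apply: thomog_sum => x xf.
rewrite [g]tbasisE mulr_sumr big_seq; apply: thomog_sum => y yg.
rewrite -scalerAl -scalerAr; do 2!apply: thomogZ.
rewrite tbasisM; case: pcompP => [z _ _ _ az|_] /=; last exact: thomog0.
rewrite -(hf x xf) -(hg y yg) /plength -size_cat -az; exact: thomog_tbasis.
Qed.

Lemma relation_homog r : relation r -> thomog 2 (r : T).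
Proof.
have h a b : thomog 2 (tgen k a * tgen k b).
  by apply: (@thomogM 1 1); apply: thomog_tbasis.
have hB f g : thomog 2 f -> thomog 2 g -> thomog 2 (f - g : T).
  by move=> hf hg; apply: thomogD => //; rewrite -scaleN1r; apply: thomogZ.
case=> [i j _|i j|i j _|i j|i j|i j|i j _|i j].
- exact: h.
- by apply: hB; apply: h.
- exact: h.
- by apply: hB; apply: h.
- by apply: thomogD; apply: h.
- by apply: thomogD; apply: h.
- by apply: thomogD; apply: h.
- by apply: hB; apply: thomogD; apply: h.
Qed.

End Paths.

Section Functionals.
Variable k : fieldType.
Local Notation T := (tensor_alg k).
Local Notation tb := (tbasis k).
Variables (wt : qpath -> k^o) (u v : vertex).
Hypothesis wtP : forall q, wt q != 0 -> [/\ (plength q <= 2)%N, pstart q = u & pend q = v].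

(** The functional sees only paths of length at most two from [u] to [v], and
    [r] already uses up length two, so only the trivial paths at [u] and [v]
    can contribute to the outer factors. *)
Lemma lext_sandwich x z (r : T) : thomog 2 r ->
  lext wt (tb x * r * tb z) = ((x == ptriv u) && (z == ptriv v))%:R * lext wt r.
Proof.
move=> hr; rewrite [r in LHS]tbasisE mulr_sumr mulr_suml linear_sum /=.
rewrite [lext wt r]/lext mulr_sumr; apply: eq_big_seq => y /hr hy.
rewrite -scalerAr -scalerAl linearZ /=.
rewrite (_ : forall b c : k, b * (c *: wt y) = c *: (b * wt y : k^o)); last first.
  by move=> b c; exact: mulrCA.
congr (_ *: _).
have wt0 q : ~~ [&& plength q <= 2, pstart q == u & pend q == v]%N -> wt q = 0.
  by move/negP=> h; apply/eqP/negPn/negP => /wtP[h1 h2 h3]; case: h; rewrite h1 h2 h3 !eqxx.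
rewrite tbasisM; case: (pcompP x y) => [p exy sp ep ap|nxy] /=; last first.
  rewrite mul0r linear0; case: eqP => [xu|]; last by rewrite mul0r.
  rewrite (wt0 y) ?mulr0 //; apply/and3P=> -[_ /eqP yu _].
  by apply: nxy; rewrite xu yu.
rewrite tbasisM; case: (pcompP p z) => [q epz sq eq aq|npz] /=; last first.
  rewrite linear0; case: (z =P _) => [zv|]; last by rewrite andbF mul0r.
  rewrite (wt0 y) ?mulr0 //; apply/and3P=> -[_ _ /eqP yv].
  by apply: npz; rewrite zv ep yv.
rewrite lext_tbasis; case: (x =P _) => [xu|nx] /=; last first.
  rewrite mul0r; apply: wt0; apply/and3P => -[lq /eqP su /eqP eu]; apply: nx.
  apply: qpathP; first by rewrite -sp -sq su.
  move: lq; rewrite /plength aq ap !size_cat -/(plength y) hy.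
  by case: (parrows x) => //= a s; rewrite !addnS !addSn.
case: (z =P _) => [zv|nz] /=; last first.
  rewrite mul0r; apply: wt0; apply/and3P => -[lq /eqP su /eqP eu]; apply: nz.
  have az : parrows z = [::].
    move: lq; rewrite /plength aq ap !size_cat -/(plength y) hy.
    by case: (parrows z) => //= a s; rewrite !addnS !addSn.
  by apply: qpathP; rewrite ?az // -eu eq /pend az.
rewrite mul1r; congr wt; apply: qpathP; first by rewrite sq sp -exy xu.
by rewrite aq ap xu zv /= cats0.
Qed.

Hypothesis wt_rel : forall r : T, relation r -> lext wt r = 0.

(** For a functional concentrated in degrees at most two and on one pair of
    vertices, vanishing on the relations is enough, since the relations are
    homogeneous of degree two. *)
Lemma lext_ideal (t : T) : ideal_gen (@relation k) t -> lext wt t = 0.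
Proof.
elim=> [|x y _ hx _ hy|a r b hr]; first exact: linear0.
  by rewrite linearD /= hx hy addr0.
elim/tensor_ind: a => [|f g hf hg|c x]; first by rewrite !mul0r linear0.
  by rewrite !mulrDl linearD /= hf hg addr0.
elim/tensor_ind: b => [|f g hf hg|d y]; first by rewrite !mulr0 linear0.
  by rewrite !mulrDr linearD /= hf hg addr0.
rewrite -!scalerAl -scalerAr !linearZ /= lext_sandwich; last exact: relation_homog.
by rewrite wt_rel // mulr0 !scaler0.
Qed.

End Functionals.

Section LambdaFunctionals.
Variable k : fieldType.
Local Notation T := (tensor_alg k).

Definition Lrepr (l : Lambda k) : T := @qrepr k T (@relation k) (@relation_proper k) l.

Lemma LreprK l : Lproj (Lrepr l) = l.
Proof. exact: qreprK. Qed.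

Lemma LprojP (t u : T) : Lproj t = Lproj u <-> ideal_gen (@relation k) (t - u).
Proof. exact: qclassP. Qed.

Lemma Lproj_is_linear : linear (@Lproj k).
Proof. by move=> a x y; rewrite LprojD LprojZ. Qed.

HB.instance Definition _ :=
  GRing.isLinear.Build k T (Lambda k) _ (@Lproj k) Lproj_is_linear.

Section Descend.
Variables (M : lmodType k) (g : {linear T -> M}).
Hypothesis g_ideal : forall t, ideal_gen (@relation k) t -> g t = 0.

(** The vanishing on the ideal is an argument so that the linear structure of
    the induced map can be inferred. *)
Definition descend of (forall t, ideal_gen (@relation k) t -> g t = 0) :=
  fun l => g (Lrepr l).

Lemma descendE t : descend g_ideal (Lproj t) = g t.
Proof.
apply/eqP; rewrite -subr_eq0 -linearB; apply/eqP/g_ideal.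
by apply/LprojP; rewrite LreprK.
Qed.

Lemma descend_is_linear : linear (descend g_ideal).
Proof.
by move=> a x y; rewrite -[x]LreprK -[y]LreprK -linearP !descendE linearP.
Qed.

HB.instance Definition _ :=
  GRing.isLinear.Build k (Lambda k) M _ (descend g_ideal) descend_is_linear.

End Descend.

Lemma arrow_coef_subproof b t :
  ideal_gen (@relation k) t -> lext (fun q => (q == parrow b)%:R : k^o) t = 0.
Proof.
apply: (@lext_ideal _ _ (src b) (tgt b)) => [q|r hr].
  by case: (q =P _) => [->|_] //; rewrite eqxx.
rewrite /lext big1_seq // => q /= /(relation_homog hr) qr.
case: (q =P _) => [qb|_]; last by rewrite scaler0.
by move: qr; rewrite qb.
Qed.

Definition Lcoef (b : arrow) (l : Lambda k) : k^o :=
  descend (@arrow_coef_subproof b) l.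

HB.instance Definition _ b := GRing.isLinear.Build k (Lambda k) k^o _
  (Lcoef b) (descend_is_linear (@arrow_coef_subproof b)).

Lemma LcoefE b t : Lcoef b (Lproj t) = t@_(parrow b).
Proof.
rewrite /Lcoef descendE.
rewrite [in RHS](tbasisE t) tcoef_sum; apply: eq_bigr => x _.
by rewrite mcoeffZ tbasis_coef.
Qed.

Lemma Lcoef_gen a b : Lcoef b (Lgen k a) = (a == b)%:R.
Proof.
rewrite LcoefE tbasis_coef; congr (nat_of_bool _)%:R; apply/eqP/eqP => [|->] //.
by case/(congr1 parrows).
Qed.

Lemma idem_gen u a : Lidem k u * Lgen k a = (u == src a)%:R *: Lgen k a.
Proof.
rewrite -LprojM /tidem /tgen tbasisM pcomp_trivl /=.
by case: eqP => _; rewrite ?scale1r // scale0r Lproj0.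
Qed.

Lemma gen_idem u a : Lgen k a * Lidem k u = (u == tgt a)%:R *: Lgen k a.
Proof.
rewrite -LprojM /tidem /tgen tbasisM pcomp_trivr /=.
by case: eqP => _; rewrite ?scale1r // scale0r Lproj0.
Qed.

Lemma idem_idem u v : Lidem k u * Lidem k v = (u == v)%:R *: Lidem k v.
Proof.
rewrite -LprojM /tidem tbasisM pcomp_trivl /=.
by case: eqP => _; rewrite ?scale1r // scale0r Lproj0.
Qed.

(** The degree zero part is spanned by the idempotents, hence commutative; this
    forces derivations to vanish on the idempotents. *)
Lemma Lhomog0P l : Lhomog 0 l -> exists a : vertex -> k, l = \sum_u a u *: Lidem k u.
Proof.
case=> t ht ->; exists (fun u => t@_(ptriv u)).
rewrite (eq_bigr (fun u => Lproj (t@_(ptriv u) *: tidem k u))); last first.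
  by move=> u _; rewrite LprojZ.
rewrite -linear_sum; congr Lproj; apply/malgP => q; rewrite tcoef_sum.
case: (boolP (q \in msupp t)) => [/ht|nq].
  move=> q0; have -> : q = ptriv (pstart q).
    by apply: qpathP => //; apply/eqP; rewrite -size_eq0; apply/eqP.
  rewrite (bigD1 (pstart q)) //= mcoeffZ tbasis_coef eqxx mulr1 big1 ?addr0 // => u.
  move=> nu; rewrite mcoeffZ tbasis_coef; case: eqP => [/(congr1 pstart) e|_].
    by case/eqP: nu.
  by rewrite mulr0.
rewrite mcoeff_outdom // big1 // => u _; rewrite mcoeffZ tbasis_coef.
case: eqP => [e|_]; last by rewrite mulr0.
by rewrite e mcoeff_outdom // mul0r.
Qed.

Lemma Lhomog1E l : Lhomog 1 l -> l = \sum_b Lcoef b l *: Lgen k b.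
Proof.
case=> t ht ->.
rewrite (eq_bigr (fun b => Lproj (t@_(parrow b) *: tgen k b))); last first.
  by move=> u _; rewrite LprojZ LcoefE.
rewrite -linear_sum; congr Lproj; apply/malgP => q; rewrite tcoef_sum.
case: (boolP (q \in msupp t)) => [/ht|nq].
  move=> q1; have [b ->] : exists b, q = parrow b.
    move: q1; rewrite /plength /parrows.
    case: q => [[u [|b [|c s]]] qc] //= _; exists b; apply: qpathP => //.
    by rewrite /pstart /=; move: (qc) => /= /andP[/eqP].
  rewrite (bigD1 b) //= mcoeffZ tbasis_coef eqxx mulr1 big1 ?addr0 // => c.
  move=> nc; rewrite mcoeffZ tbasis_coef; case: eqP => [/(congr1 parrows) [e]|_].
    by case/eqP: nc.
  by rewrite mulr0.
rewrite mcoeff_outdom // big1 // => b _; rewrite mcoeffZ tbasis_coef.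
case: eqP => [e|_]; last by rewrite mulr0.
by rewrite e mcoeff_outdom // mul0r.
Qed.

(** This is how products of generators are shown to be nonzero, and
    independent, in [Lambda]: a weight on pairs of arrows that respects the
    relations becomes a functional whose values on products are known. *)
Lemma Lambda_functional (w : arrow -> arrow -> k) (u v : vertex) :
  (forall a b, w a b != 0 -> src a = u /\ tgt b = v) ->
  (forall (psi : {linear T -> k^o}),
     (forall a b, tgt a = src b -> psi (tgen k a * tgen k b) = w a b) ->
     forall r, relation r -> psi r = 0) ->
  exists psi : {linear Lambda k -> k^o},
    forall a b, tgt a = src b -> psi (Lgen k a * Lgen k b) = w a b.
Proof.
move=> wuv wrel.
pose wt q : k^o := if parrows q is [:: a; b] then w a b else 0.
have wtE a b : tgt a = src b -> lext wt (tgen k a * tgen k b) = w a b.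
  by move=> e; have [q -> h] := tgen_tgen k e; rewrite lext_tbasis /wt h.
have wt0 t : ideal_gen (@relation k) t -> lext wt t = 0.
  apply: (@lext_ideal _ _ u v) => [q|r]; last exact: (wrel (lext wt)).
  rewrite /wt /plength /pend /pstart /parrows; case: q => [[x s] qc] /=.
  case: s qc => [|a [|b [|c s]]]; rewrite ?eqxx //= => qc /wuv[<- <-].
  by split=> //; case/andP: qc => /eqP.
exists (descend wt0) => a b e.
rewrite -LprojM -[LHS]/(descend wt0 (Lproj _)) descendE; exact: wtE.
Qed.

End LambdaFunctionals.

(** * Derivations of the tensor algebra *)
Section Words.
Variable k : fieldType.
Local Notation T := (tensor_alg k).
Local Notation tb := (tbasis k).

Definition word (s : seq arrow) : T := \prod_(a <- s) tgen k a.

Lemma word_cat s t : word (s ++ t) = word s * word t.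
Proof. exact: big_cat. Qed.

Lemma word_cons a s : word (a :: s) = tgen k a * word s.
Proof. exact: big_cons. Qed.

Lemma tidem_tgen a : tidem k (src a) * tgen k a = tgen k a.
Proof. by rewrite /tidem /tgen tbasisM pcomp_trivl /= eqxx. Qed.

Lemma tgen_tidem a : tgen k a * tidem k (tgt a) = tgen k a.
Proof. by rewrite /tidem /tgen tbasisM pcomp_trivr /= eqxx. Qed.

Lemma tbasis_word q : tb q = tidem k (pstart q) * word (parrows q).
Proof.
case: q => [[u s] qc]; rewrite /pstart /parrows /=.
elim: s u qc => [|a s IHs] u qc.
  rewrite /word big_nil mulr1; congr tb; exact: qpathP.
have /andP[/eqP au sc] : (src a == u) && composable (tgt a) s by [].
subst u; rewrite word_cons mulrA tidem_tgen -[in RHS]tgen_tidem -mulrA -(IHs _ sc).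
rewrite /tgen tbasisM; case: pcompP => [z _ sz _ az|[]] //=; congr tb.
by apply: qpathP; rewrite ?sz ?az.
Qed.

Lemma thomog_word s : thomog (size s) (word s).
Proof.
elim: s => [|a s IHs].
  rewrite /word big_nil -[X in thomog _ X]/(tone k); apply: thomog_sum => u _.
  exact: thomog_tbasis.
by rewrite word_cons; apply: (@thomogM _ 1) => //; apply: thomog_tbasis.
Qed.

Lemma word_idem u v s : composable u s ->
  tidem k u * word s * tidem k v = (v == endpoint u s)%:R *: (tidem k u * word s).
Proof.
move=> sc; pose q : qpath := exist _ (u, s) sc.
rewrite -[_ * word s]/(tidem k (pstart q) * word (parrows q)) -tbasis_word.
rewrite tbasisM pcomp_trivr -/(pend q).
by case: eqP => _; rewrite ?scale1r ?scale0r.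
Qed.

Section Derivation.
Variable d : arrow -> T.
Hypothesis d_src : forall a, tidem k (src a) * d a = d a.
Hypothesis d_tgt : forall a, d a * tidem k (tgt a) = d a.
Hypothesis d_homog : forall a, thomog 1 (d a).

Fixpoint dword (s : seq arrow) : T :=
  if s is a :: s' then d a * word s' + tgen k a * dword s' else 0.

Lemma dword_cat s t : dword (s ++ t) = dword s * word t + word s * dword t.
Proof.
elim: s => [|a s IHs] /=; first by rewrite mul0r add0r /word big_nil mul1r.
by rewrite IHs word_cons word_cat mulrDl mulrDr !mulrA addrA.
Qed.

Lemma dword_homog s : thomog (size s) (dword s).
Proof.
elim: s => [|a s IHs]; first exact: thomog0.
apply: thomogD; apply: (@thomogM _ 1) => //; first exact: thomog_word.
exact: thomog_tbasis.
Qed.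

(** Inserting [d] into a path keeps its end points. This makes both sides of
    the Leibniz rule vanish on paths that are not composable. *)
Lemma dword_idem u v s : composable u s ->
  tidem k u * dword s * tidem k v = (v == endpoint u s)%:R *: (tidem k u * dword s).
Proof.
elim: s u => [|a s IHs] u; first by rewrite /= !mulr0 mul0r scaler0.
case/andP=> /eqP <- sc.
have -> : tidem k (src a) * dword (a :: s) =
    d a * (tidem k (tgt a) * word s) + tgen k a * (tidem k (tgt a) * dword s).
  by rewrite /= mulrDr !mulrA d_src tidem_tgen d_tgt tgen_tidem.
rewrite mulrDl -(mulrA (d a)) -(mulrA (tgen k a)) word_idem // IHs //.
by rewrite -!scalerAr -scalerDr.
Qed.

Definition tder : T -> T := lext (fun q => tidem k (pstart q) * dword (parrows q)).

HB.instance Definition _ := GRing.Linear.on tder.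

Lemma tder_tbasis q : tder (tb q) = tidem k (pstart q) * dword (parrows q).
Proof. exact: lext_tbasis. Qed.

Lemma tderM f g : tder (f * g) = tder f * g + f * tder g.
Proof.
elim/tensor_ind: f => [|f1 f2 h1 h2|a x].
- by rewrite !(mul0r, linear0) addr0.
- by rewrite !(mulrDl, linearD) /= h1 h2 addrACA.
elim/tensor_ind: g => [|g1 g2 h1 h2|b y].
- by rewrite !(mulr0, linear0) addr0.
- by rewrite !(mulrDr, linearD) /= h1 h2 addrACA.
rewrite -!scalerAl -!scalerAr !linearZ /= -!scalerAl -!scalerAr.
rewrite [b *: (a *: _)]scalerA [b * a]mulrC -scalerA -!scalerDr.
congr (_ *: (_ *: _)); rewrite tbasisM !tder_tbasis.
have := word_idem (pstart y) (valP x); rewrite -/(pstart x) -/(parrows x) -/(pend x) => wx.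
have := dword_idem (pstart y) (valP x); rewrite -/(pstart x) -/(parrows x) -/(pend x) => dx.
rewrite [tb x]tbasis_word [tb y]tbasis_word 2![in RHS]mulrA wx dx.
case: pcompP => [z exy sz _ az|nxy] /=.
  by rewrite tder_tbasis sz az dword_cat mulrDr !mulrA exy eqxx !scale1r.
by rewrite linear0 eq_sym; case: eqP => // _; rewrite !scale0r !mul0r addr0.
Qed.

Lemma tder_homog n f : thomog n f -> thomog n (tder f).
Proof.
move=> hf; rewrite [f]tbasisE linear_sum big_seq; apply: thomog_sum => q qf.
rewrite linearZ /=; apply: thomogZ; rewrite tder_tbasis.
apply: (@thomogM _ 0); first exact: thomog_tbasis.
by rewrite -(hf _ qf); apply: dword_homog.
Qed.

Lemma tder_tidem u : tder (tidem k u) = 0.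
Proof. by rewrite /tidem tder_tbasis mulr0. Qed.

Lemma tder_tgen a : tder (tgen k a) = d a.
Proof.
by rewrite /tgen tder_tbasis /= /word big_nil mulr1 mulr0 addr0 d_src.
Qed.

End Derivation.
End Words.

(** * Derivations of the quotient algebra *)
Section LambdaDerivations.
Variable k : fieldType.
Local Notation T := (tensor_alg k).
Local Notation L := (Lambda k).
Local Notation der := (der0 (@Lgrading k)).

Lemma derZ (D : der) c x : D (c *: x) = c *: D x.
Proof. exact: linearZ. Qed.

Lemma der_sum (D : der) I (r : seq I) (P : pred I) (G : I -> L) :
  D (\sum_(i <- r | P i) G i) = \sum_(i <- r | P i) D (G i).
Proof. exact: linear_sum. Qed.

(** Relations are combinations of products of two generators. *)
Lemma relation_ext (M : lmodType k) (E F : {linear T -> M}) :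
  (forall a b, E (tgen k a * tgen k b) = F (tgen k a * tgen k b)) ->
  forall r, relation r -> E r = F r.
Proof.
move=> h r; case=> [i j _|i j|i j _|i j|i j|i j|i j _|i j].
- exact: h.
- by rewrite (linearB E) (linearB F) !h.
- exact: h.
- by rewrite (linearB E) (linearB F) !h.
- by rewrite (linearD E) (linearD F) !h.
- by rewrite (linearD E) (linearD F) !h.
- by rewrite (linearD E) (linearD F) !h.
- by rewrite (linearB E) (linearB F) !(linearD E) !(linearD F) !h.
Qed.

Lemma Lproj_paths (t : T) :
  Lproj t = \sum_(q <- msupp t) t@_q *: Lproj (tbasis k q).
Proof.
rewrite [t in LHS]tbasisE [LHS]linear_sum; apply: eq_bigr => q _; exact: LprojZ.
Qed.

Lemma Lproj_rel (r : T) : relation r -> Lproj r = 0.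
Proof.
move=> hr; rewrite -(Lproj0 k); apply/LprojP; rewrite subr0.
by rewrite -[r]mulr1 -[r * 1]mul1r mulrA; constructor.
Qed.

(** The matrix [m] prescribes the derivation on generators. The condition on
    relations is phrased for an arbitrary linear map with the Leibniz values on
    products of two generators, so that checking it is a computation in
    [Lambda] only. *)
Lemma Lambda_der (m : arrow -> arrow -> k) :
  (forall a b, m a b != 0 -> src b = src a /\ tgt b = tgt a) ->
  (forall E : {linear T -> L},
     (forall a b, E (tgen k a * tgen k b) =
        (\sum_c m a c *: Lgen k c) * Lgen k b +
        Lgen k a * (\sum_c m b c *: Lgen k c)) ->
     forall r, relation r -> E r = 0) ->
  exists D : der, (forall u, D (Lidem k u) = 0) /\
    forall a, D (Lgen k a) = \sum_c m a c *: Lgen k c.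
Proof.
move=> hm hr; pose d a := \sum_c m a c *: tgen k c.
have d_src a : tidem k (src a) * d a = d a.
  rewrite mulr_sumr; apply: eq_bigr => c _; rewrite -scalerAr.
  have [->|/hm[<- _]] := eqVneq (m a c) 0; first by rewrite !scale0r.
  by rewrite tidem_tgen.
have d_tgt a : d a * tidem k (tgt a) = d a.
  rewrite mulr_suml; apply: eq_bigr => c _; rewrite -scalerAl.
  have [->|/hm[_ <-]] := eqVneq (m a c) 0; first by rewrite !scale0r.
  by rewrite tgen_tidem.
have d_homog a : thomog 1 (d a).
  by apply: thomog_sum => c _; apply/thomogZ/thomog_tbasis.
have dE a : Lproj (d a) = \sum_c m a c *: Lgen k c.
  by rewrite linear_sum; apply: eq_bigr => c _; rewrite linearZ.
pose E : {linear T -> L} := @Lproj k \o tder d.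
have Er r : relation r -> E r = 0.
  apply: hr => a b.
  by rewrite /E /= tderM // !tder_tgen // LprojD !LprojM !dE.
have EI t : ideal_gen (@relation k) t -> E t = 0.
  elim=> [|x y _ hx _ hy|a r b hr']; first exact: linear0.
    by rewrite linearD hx hy addr0.
  rewrite /E /= !tderM // !(LprojD, LprojM, mulrDl).
  have := Er _ hr'; rewrite /E /= => ->.
  by rewrite (Lproj_rel hr') !(mulr0, mul0r) !addr0.
have Dder : descend EI \in der0_pred (@Lgrading k).
  apply/der0_predP; split=> [|x y|n x [t ht ->]].
  - exact: linearP.
  - rewrite -[x]LreprK -[y]LreprK -LprojM !descendE /E /=.
    by rewrite tderM // LprojD !LprojM.
  - rewrite descendE /E /=; exists (tder d t) => //; exact: tder_homog.
exists (Der0 Dder); split=> [u|a].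
  by rewrite -[LHS]/(descend EI (Lproj _)) descendE /E /= tder_tidem Lproj0.
by rewrite -[LHS]/(descend EI (Lproj _)) descendE /E /= tder_tgen.
Qed.

(** The case [c = 1] is the grading derivation; the case [c = 0] shows that a
    derivation is determined by its values on idempotents and generators. *)
Lemma der_word (D : der) (c : k) : (forall u, D (Lidem k u) = 0) ->
  (forall a, D (Lgen k a) = c *: Lgen k a) ->
  forall q, D (Lproj (tbasis k q)) = (plength q)%:R *: (c *: Lproj (tbasis k q)).
Proof.
move=> Du Da q; rewrite tbasis_word LprojM der0M Du mul0r add0r !scalerAr.
rewrite -/(Lidem k _); congr (_ * _); rewrite /plength.
elim: (parrows q) => [|a s IHs].
  rewrite /word big_nil scale0r Lproj1.
  by apply: (addrI (D 1)); rewrite addr0 -[in RHS](mulr1 1) der0M mulr1 mul1r.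
rewrite word_cons LprojM der0M IHs Da -!scalerAr -!scalerAl -/(Lgen k a).
by rewrite -[(size (a :: s))%:R]/(1 *+ _) mulrS scalerDl scale1r.
Qed.

Lemma der_eq (D E : der) : (forall u, D (Lidem k u) = E (Lidem k u)) ->
  (forall a, D (Lgen k a) = E (Lgen k a)) -> D = E.
Proof.
move=> hu ha; pose F : der := D - E.
have FE x : F x = D x - E x by [].
have F0 : forall q, F (Lproj (tbasis k q)) = 0.
  move=> q; rewrite (@der_word F 0) ?scale0r ?scaler0 // => [u|a].
    by rewrite FE hu subrr.
  by rewrite FE ha subrr scale0r.
apply: der0_eq => x; apply/eqP; rewrite -subr_eq0 -FE -[x]LreprK.
by rewrite Lproj_paths der_sum big1 // => q _; rewrite derZ F0 scaler0.
Qed.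

(** The identity on generators doubles each quadratic relation, so it defines a
    derivation; by the Leibniz rule it multiplies a path by its length. *)
Lemma grading_der : exists D : der,
  [/\ is_grading_der D, forall u, D (Lidem k u) = 0
    & forall a, D (Lgen k a) = Lgen k a].
Proof.
have [|E EM r hr|D [Du Da]] := @Lambda_der (fun a b => (a == b)%:R).
- by move=> a b; case: (a =P b) => [->|_]; rewrite ?eqxx.
- have {}EM a b : E (tgen k a * tgen k b) = 2%:R *: Lproj (tgen k a * tgen k b).
    have gE c : \sum_c' (c == c')%:R *: Lgen k c' = Lgen k c.
      rewrite (bigD1 c) //= eqxx scale1r big1 ?addr0 // => c' /negPf nc.
      by rewrite eq_sym nc scale0r.
    by rewrite EM !gE LprojM scaler_nat.
  have -> : E r = 2%:R *: Lproj r.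
    pose F : {linear T -> L} := 2%:R \*: (@Lproj k : {linear T -> L}).
    exact: (@relation_ext _ E F).
  by rewrite Lproj_rel // scaler0.
have {}Da a : D (Lgen k a) = Lgen k a.
  rewrite Da (bigD1 a) //= eqxx scale1r big1 ?addr0 // => c' /negPf nc.
  by rewrite eq_sym nc scale0r.
exists D; split=> // n l [t ht ->].
rewrite [Lproj t]Lproj_paths der_sum scaler_sumr; apply: eq_big_seq => q /ht <-.
have D1 a : D (Lgen k a) = 1 *: Lgen k a by rewrite scale1r.
by rewrite derZ (der_word Du D1) scale1r scalerA mulrC -scalerA.
Qed.

End LambdaDerivations.

(** * The action of gl_3 *)
Section InvariantRelations.
Variables (k : fieldType) (A : algType k).
Implicit Types (c : 'I_3 -> k) (F : 'I_3 -> A) (X : 'M[k]_3).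

Lemma lincomb_delta F j : \sum_i (i == j)%:R *: F i = F j.
Proof.
rewrite (bigD1 j) //= eqxx scale1r big1 ?addr0 // => i /negPf ->.
exact: scale0r.
Qed.

Lemma lincomb_deltal c F j z :
  (forall i, F i = (i == j)%:R *: z) -> \sum_i c i *: F i = c j *: z.
Proof.
move=> h; rewrite -[RHS](lincomb_delta (fun i => c i *: z)); apply: eq_bigr => i _.
by rewrite h !scalerA mulrC.
Qed.

Lemma lincomb_deltar c F j z :
  (forall i, F i = (j == i)%:R *: z) -> \sum_i c i *: F i = c j *: z.
Proof. by move=> h; apply: lincomb_deltal => i; rewrite h eq_sym. Qed.

Lemma lincomb_zero c F : (forall i, F i = 0) -> \sum_i c i *: F i = 0.
Proof. by move=> h; rewrite big1 // => i _; rewrite h scaler0. Qed.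

Lemma lincomb_mull c F y : (\sum_i c i *: F i) * y = \sum_i c i *: (F i * y).
Proof. by rewrite mulr_suml; apply: eq_bigr => i _; rewrite scalerAl. Qed.

Lemma lincomb_mulr c F y : y * (\sum_i c i *: F i) = \sum_i c i *: (y * F i).
Proof. by rewrite mulr_sumr; apply: eq_bigr => i _; rewrite scalerAr. Qed.

(** The four terms of the Leibniz rule, applied to a relation with two
    summands, regroup so that the relation itself appears in each sum. *)
Lemma lincomb_cross a b F G F' G' :
  \sum_i a i *: F i + \sum_i b i *: G i +
    (\sum_i b i *: F' i + \sum_i a i *: G' i) =
  \sum_i a i *: (F i + G' i) + \sum_i b i *: (G i + F' i).
Proof.
rewrite [X in _ + X]addrC addrACA.
by congr (_ + _); rewrite -big_split; apply: eq_bigr => i _; rewrite scalerDr.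
Qed.

(** A multiple of the natural pairing between a module and its dual is
    invariant. *)
Lemma dual_pairing_invariant (xi x : 'I_3 -> A) z X i j :
  (forall i j, xi i * x j = (i == j)%:R *: z) ->
  (\sum_l - X i l *: xi l) * x j + xi i * (\sum_l X l j *: x l) = 0.
Proof.
move=> h; rewrite lincomb_mull lincomb_mulr (lincomb_deltal _ (fun l => h l j)).
by rewrite (lincomb_deltar _ (h i)) -scalerDl addNr scale0r.
Qed.

Lemma pairing_dual_invariant (x xi : 'I_3 -> A) z X i j :
  (forall i j, x i * xi j = (i == j)%:R *: z) ->
  (\sum_l X l i *: x l) * xi j + x i * (\sum_l - X j l *: xi l) = 0.
Proof.
move=> h; rewrite lincomb_mull lincomb_mulr (lincomb_deltal _ (fun l => h l j)).
by rewrite (lincomb_deltar _ (h i)) -scalerDl addrN scale0r.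
Qed.

(** The symmetric square is a submodule of the tensor square, so the condition
    that it be killed is invariant under every matrix. The matrix is a plain
    function of two indices, to cover the dual action as well. *)
Lemma alternating_invariant (x y : 'I_3 -> A) (X : 'I_3 -> 'I_3 -> k) i j :
  (forall i j, y i * x j + y j * x i = 0) ->
  (\sum_l X l i *: y l) * x j + y i * (\sum_l X l j *: x l) +
  ((\sum_l X l j *: y l) * x i + y j * (\sum_l X l i *: x l)) = 0.
Proof. by move=> h; rewrite !lincomb_mull !lincomb_mulr lincomb_cross !lincomb_zero ?addr0. Qed.

(** The sum [x_i xi_j + eta_j y_i] is again a multiple of the natural pairing;
    only the sum is preserved, not its two terms. *)
Lemma mixed_invariant (x xi y eta : 'I_3 -> A) z X i j :
  (forall i j, x i * xi j + eta j * y i = (i == j)%:R *: z) ->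
  (\sum_l X l i *: x l) * xi j + x i * (\sum_l - X j l *: xi l) +
  ((\sum_l - X j l *: eta l) * y i + eta j * (\sum_l X l i *: y l)) = 0.
Proof.
move=> h; rewrite !lincomb_mull !lincomb_mulr lincomb_cross (lincomb_deltal _ (fun l => h l j)).
by rewrite (lincomb_deltar _ (h i)) -scalerDl addrN scale0r.
Qed.

End InvariantRelations.

Section QuadraticRelations.
Variable k : fieldType.
Local Notation T := (tensor_alg k).
Local Notation L := (Lambda k).
Local Notation g := (Lgen k).
Local Notation der := (der0 (@Lgrading k)).

Lemma sum_arrow (V : nmodType) (F : arrow -> V) :
  \sum_a F a = \sum_i F (Vpos i) + \sum_i F (Vneg i)
             + (\sum_i F (Wpos i) + \sum_i F (Wneg i)).
Proof.
have arrow_ofK : bijective arrow_of.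
  by exists arrow_to; [case=> -[[] []]|exact: arrow_toK].
rewrite (reindex arrow_of) /=; last exact: onW_bij.
transitivity (\sum_(c : bool * bool * 'I_3) F (arrow_of (c.1.1, c.1.2, c.2))).
  by apply: eq_bigr => -[[b c] i].
rewrite -(pair_bigA _ (fun (b : bool * bool) i => F (arrow_of (b.1, b.2, i)))) /=.
rewrite -(pair_bigA _ (fun b c : bool => \sum_i F (arrow_of (b, c, i)))) /=.
by rewrite !big_bool.
Qed.

Lemma Lproj_eq (t u : T) : relation (t - u) -> Lproj t = Lproj u.
Proof.
move/Lproj_rel => h; apply/eqP; rewrite -subr_eq0 -scaleN1r -LprojZ -LprojD.
by rewrite scaleN1r h.
Qed.

(** The products with index [0] serve as names for the common value of the
    diagonal products, here and for the other families. *)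
Lemma vnvpE i j : g (Vneg i) * g (Vpos j) = (i == j)%:R *: (g (Vneg 0) * g (Vpos 0)).
Proof.
rewrite -!LprojM; case: eqVneq => [<-|ij].
  by rewrite scale1r; apply: Lproj_eq; apply: Rel_vv_eq.
by rewrite scale0r; apply: Lproj_rel; apply: Rel_vv_ne.
Qed.

Lemma wpwnE i j : g (Wpos i) * g (Wneg j) = (i == j)%:R *: (g (Wpos 0) * g (Wneg 0)).
Proof.
rewrite -!LprojM; case: eqVneq => [<-|ij].
  by rewrite scale1r; apply: Lproj_eq; apply: Rel_ww_eq.
by rewrite scale0r; apply: Lproj_rel; apply: Rel_ww_ne.
Qed.

Lemma wpvpE i j : g (Wpos i) * g (Vpos j) + g (Wpos j) * g (Vpos i) = 0.
Proof. by rewrite -!LprojM -LprojD; apply: Lproj_rel; apply: Rel_wv. Qed.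

Lemma vnwnE i j : g (Vneg i) * g (Wneg j) + g (Vneg j) * g (Wneg i) = 0.
Proof. by rewrite -!LprojM -LprojD; apply: Lproj_rel; apply: Rel_vw. Qed.

Lemma vpvnE i j : g (Vpos i) * g (Vneg j) + g (Wneg j) * g (Wpos i) =
  (i == j)%:R *: (g (Vpos 0) * g (Vneg 0) + g (Wneg 0) * g (Wpos 0)).
Proof.
rewrite -!LprojM -!LprojD; case: eqVneq => [<-|ij].
  by rewrite scale1r; apply: Lproj_eq; apply: Rel_vvww_eq.
by rewrite scale0r; apply: Lproj_rel; apply: Rel_vvww_ne.
Qed.

Definition gl_coef (X : 'M[k]_3) (a b : arrow) : k :=
  match a, b with
  | Vpos j, Vpos i => X i j
  | Vneg j, Vneg i => - X j i
  | Wpos j, Wpos i => X i j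
  | Wneg j, Wneg i => - X j i
  | _, _ => 0
  end.

Definition is_gl_der (X : 'M[k]_3) (D : der) : Prop :=
  [/\ forall u, D (Lidem k u) = 0,
      forall j, D (g (Vpos j)) = \sum_i X i j *: g (Vpos i),
      forall j, D (g (Vneg j)) = \sum_i - X j i *: g (Vneg i),
      forall j, D (g (Wpos j)) = \sum_i X i j *: g (Wpos i)
    & forall j, D (g (Wneg j)) = \sum_i - X j i *: g (Wneg i)].

Lemma zero_coef_sum (F : 'I_3 -> L) : \sum_i (0 : k) *: F i = 0.
Proof. by rewrite big1 // => i _; rewrite scale0r. Qed.

Lemma gl_coefE (X : 'M[k]_3) : [/\
  forall j, \sum_b gl_coef X (Vpos j) b *: g b = \sum_i X i j *: g (Vpos i),
  forall j, \sum_b gl_coef X (Vneg j) b *: g b = \sum_i - X j i *: g (Vneg i),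
  forall j, \sum_b gl_coef X (Wpos j) b *: g b = \sum_i X i j *: g (Wpos i)
& forall j, \sum_b gl_coef X (Wneg j) b *: g b = \sum_i - X j i *: g (Wneg i)].
Proof. by split=> j; rewrite sum_arrow /= !zero_coef_sum ?addr0 ?add0r. Qed.

Lemma gl_der_exists X : exists D : der, is_gl_der X D.
Proof.
have [e1 e2 e3 e4] := gl_coefE X.
have [||D [Du Da]] := @Lambda_der k (gl_coef X); last first.
  by exists D; split=> // j; rewrite Da.
- move=> E EM.
  have Evv i j : E (tgen k (Vneg i) * tgen k (Vpos j)) = 0.
    by rewrite EM e1 e2; apply: dual_pairing_invariant vnvpE.
  have Eww i j : E (tgen k (Wpos i) * tgen k (Wneg j)) = 0.
    by rewrite EM e3 e4; apply: pairing_dual_invariant wpwnE.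
  have Ewv i j : E (tgen k (Wpos i) * tgen k (Vpos j)) +
                 E (tgen k (Wpos j) * tgen k (Vpos i)) = 0.
    by rewrite (EM (Wpos i)) (EM (Wpos j)) !e3 !e1; apply: alternating_invariant wpvpE.
  have Evw i j : E (tgen k (Vneg i) * tgen k (Wneg j)) +
                 E (tgen k (Vneg j) * tgen k (Wneg i)) = 0.
    rewrite (EM (Vneg i)) (EM (Vneg j)) !e2 !e4.
    exact: (@alternating_invariant _ _ _ _ (fun l m => - X m l)) vnwnE.
  have Em i j : E (tgen k (Vpos i) * tgen k (Vneg j)) +
                E (tgen k (Wneg j) * tgen k (Wpos i)) = 0.
    by rewrite (EM (Vpos i)) (EM (Wneg j)) e1 e2 e3 e4; apply: mixed_invariant vpvnE.
  move=> r; case=> [i j _|i j|i j _|i j|i j|i j|i j _|i j].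
  + exact: Evv.
  + by rewrite (linearB E) !Evv subrr.
  + exact: Eww.
  + by rewrite (linearB E) !Eww subrr.
  + by rewrite (linearD E).
  + by rewrite (linearD E).
  + by rewrite (linearD E).
  + by rewrite (linearB E) !(linearD E) !Em subrr.
- by move=> [i|i|i|i] [j|j|j|j] //=; rewrite eqxx.
Qed.

End QuadraticRelations.

(** * Detecting products of generators *)
Section Classification.
Variable k : fieldType.
Local Notation T := (tensor_alg k).
Local Notation L := (Lambda k).
Local Notation g := (Lgen k).

Lemma functional_vnvp : exists psi : {linear L -> k^o},
  forall i j, psi (g (Vneg i) * g (Vpos j)) = (i == j)%:R.
Proof.
pose w a b : k := match a, b with Vneg i, Vpos j => (i == j)%:R | _, _ => 0 end.
have [||psi h] := @Lambda_functional k w pt_gamma pt_gamma; last first.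
  by exists psi => i j; rewrite h.
- move=> psi h r; case=> [i j /negPf ij|i j|i j ij|i j|i j|i j|i j ij|i j].
  + by rewrite h //= ij.
  + by rewrite linearB /= !h //= !eqxx subrr.
  + by rewrite h.
  + by rewrite linearB /= !h //= subrr.
  + by rewrite linearD /= !h //= addr0.
  + by rewrite linearD /= !h //= addr0.
  + by rewrite linearD /= !h //= addr0.
  + by rewrite linearB !linearD /= !h //= !(oppr0, addr0).
- by move=> [i|i|i|i] [j|j|j|j] /=; rewrite ?eqxx.
Qed.

Lemma functional_wpwn : exists psi : {linear L -> k^o},
  forall i j, psi (g (Wpos i) * g (Wneg j)) = (i == j)%:R.
Proof.
pose w a b : k := match a, b with Wpos i, Wneg j => (i == j)%:R | _, _ => 0 end.
have [||psi h] := @Lambda_functional k w pt_mu pt_mu; last first.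
  by exists psi => i j; rewrite h.
- move=> psi h r; case=> [i j ij|i j|i j /negPf ij|i j|i j|i j|i j ij|i j].
  + by rewrite h.
  + by rewrite linearB /= !h //= subrr.
  + by rewrite h //= ij.
  + by rewrite linearB /= !h //= !eqxx subrr.
  + by rewrite linearD /= !h //= addr0.
  + by rewrite linearD /= !h //= addr0.
  + by rewrite linearD /= !h //= addr0.
  + by rewrite linearB !linearD /= !h //= !(oppr0, addr0).
- by move=> [i|i|i|i] [j|j|j|j] /=; rewrite ?eqxx.
Qed.

Lemma functional_wpvp p q : exists psi : {linear L -> k^o},
  forall i j, psi (g (Wpos i) * g (Vpos j)) =
    ((i == p) && (j == q))%:R - ((i == q) && (j == p))%:R.
Proof.
pose w a b : k := match a, b with
  | Wpos i, Vpos j => ((i == p) && (j == q))%:R - ((i == q) && (j == p))%:R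
  | _, _ => 0 end.
have [||psi h] := @Lambda_functional k w pt_mu pt_gamma; last first.
  by exists psi => i j; rewrite h.
- move=> psi h r; case=> [i j ij|i j|i j ij|i j|i j|i j|i j ij|i j].
  + by rewrite h.
  + by rewrite linearB /= !h //= subrr.
  + by rewrite h.
  + by rewrite linearB /= !h //= subrr.
  + rewrite linearD /= !h //= [(j == p) && _]andbC [(j == q) && (i == p)]andbC.
    by rewrite addrA subrK subrr.
  + by rewrite linearD /= !h //= addr0.
  + by rewrite linearD /= !h //= addr0.
  + by rewrite linearB !linearD /= !h //= !(oppr0, addr0).
- by move=> [i|i|i|i] [j|j|j|j] /=; rewrite ?eqxx.
Qed.

(** The opposite signs make the functional vanish on every
    [Vpos i Vneg j + Wneg j Wpos i], hence on the relations built from these. *)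
Lemma functional_vpvn p q : exists psi : {linear L -> k^o},
  (forall i j, psi (g (Vpos i) * g (Vneg j)) = ((i == p) && (j == q))%:R) /\
  (forall i j, psi (g (Wneg j) * g (Wpos i)) = - ((i == p) && (j == q))%:R).
Proof.
pose w a b : k := match a, b with
  | Vpos i, Vneg j => ((i == p) && (j == q))%:R
  | Wneg j, Wpos i => - ((i == p) && (j == q))%:R
  | _, _ => 0 end.
have [||psi h] := @Lambda_functional k w pt_lambda pt_lambda; last first.
  by exists psi; split=> i j; rewrite h.
- move=> psi h r; case=> [i j ij|i j|i j ij|i j|i j|i j|i j ij|i j].
  + by rewrite h.
  + by rewrite linearB /= !h //= subrr.
  + by rewrite h.
  + by rewrite linearB /= !h //= subrr.
  + by rewrite linearD /= !h //= addr0.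
  + by rewrite linearD /= !h //= addr0.
  + by rewrite linearD /= !h //= addrN.
  + by rewrite linearB !linearD /= !h //= !(subrr, addr0).
- by move=> [i|i|i|i] [j|j|j|j] /=; rewrite ?eqxx.
Qed.

End Classification.

(** * The matrices of a degree zero derivation *)
Section Matrices.
Variable k : fieldType.
Local Notation L := (Lambda k).
Local Notation g := (Lgen k).
Local Notation der := (der0 (@Lgrading k)).

(** Column [j] lists the coordinates of the image of [c j], so that composition
    of derivations corresponds to the product of matrices in the same order. *)
Definition der_mx (c : 'I_3 -> arrow) (D : der) : 'M[k]_3 :=
  \matrix_(i, j) Lcoef (c i) (D (g (c j))).

Lemma der_mx_is_linear c : linear (der_mx c).
Proof. by move=> a D E; apply/matrixP => i j; rewrite !mxE linearP. Qed.

HB.instance Definition _ c :=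
  GRing.isLinear.Build k der 'M[k]_3 _ (der_mx c) (der_mx_is_linear c).

(** With [e] the idempotent, [D e = D e * e + e * D e]. As [D e] has degree zero
    it commutes with [e], so multiplying by [e] gives [D e * e = 2 (D e * e)],
    whence [D e * e = 0] and [D e = 0]. *)
Lemma der_idem (two_neq0 : 2%:R != 0 :> k) (D : der) u : D (Lidem k u) = 0.
Proof.
set e := Lidem k u; set x := D e.
have ee : e * e = e by rewrite idem_idem eqxx scale1r.
have xE : x = x * e + e * x by rewrite /x -der0M ee.
have [a xa] : exists a : vertex -> k, x = \sum_v a v *: Lidem k v.
  apply: Lhomog0P; apply: (@der0_homog _ _ (@Lgrading k) D 0).
  by exists (tidem k u) => //; apply: thomog_tbasis.
have xe : x * e = a u *: e.
  rewrite xa mulr_suml (bigD1 u) //= -scalerAl ee big1 ?addr0 // => v /negPf vu.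
  by rewrite -scalerAl idem_idem vu scale0r scaler0.
have ex : e * x = a u *: e.
  rewrite xa mulr_sumr (bigD1 u) //= -scalerAr ee big1 ?addr0 // => v vu.
  by rewrite -scalerAr idem_idem eq_sym (negPf vu) scale0r scaler0.
have : x * e = x * e + x * e.
  by rewrite {1}xE mulrDl -mulrA ee -(mulrA e) xe -scalerAr ee.
move/eqP; rewrite -[X in X == _]addr0 => /eqP/addrI/esym xe0.
by rewrite xE ex -xe xe0 addr0.
Qed.

Lemma Lcoef_sandwich u v b l : Lhomog 1 l ->
  Lcoef b (Lidem k u * l * Lidem k v) =
    ((u == src b) && (v == tgt b))%:R *: Lcoef b l.
Proof.
move/Lhomog1E => lE; rewrite {1}lE mulr_sumr mulr_suml linear_sum /=.
rewrite (bigD1 b) //= big1 => [|c /negPf cb].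
  rewrite addr0 -scalerAr -scalerAl linearZ /= idem_gen -scalerAl gen_idem.
  rewrite !linearZ /= Lcoef_gen eqxx -mulnb natrM -scalerA.
  rewrite -[LHS]/(_ * (_ * (_ * 1))) -[RHS]/(_ * (_ * _)).
  by rewrite mulr1.
rewrite -scalerAr -scalerAl linearZ /= idem_gen -scalerAl gen_idem.
by rewrite !linearZ /= Lcoef_gen cb !scaler0.
Qed.

Lemma Lcoef_der (two_neq0 : 2%:R != 0 :> k) (D : der) a b :
  ~~ ((src a == src b) && (tgt a == tgt b)) -> Lcoef b (D (g a)) = 0.
Proof.
move/negPf => ab.
have Dh : Lhomog 1 (D (g a)).
  apply: (@der0_homog _ _ (@Lgrading k) D 1).
  by exists (tgen k a) => //; apply: thomog_tbasis.
have <- : Lidem k (src a) * D (g a) * Lidem k (tgt a) = D (g a).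
  have e1 : Lidem k (src a) * D (g a) = D (g a).
    have ga : Lidem k (src a) * g a = g a by rewrite idem_gen eqxx scale1r.
    by rewrite -[in RHS]ga der0M der_idem // mul0r add0r.
  have ga : g a * Lidem k (tgt a) = g a by rewrite gen_idem eqxx scale1r.
  by rewrite e1 -[in RHS]ga der0M der_idem // mulr0 addr0.
by rewrite Lcoef_sandwich // ab scale0r.
Qed.

End Matrices.

Section Structure.
Variable k : fieldType.
Local Notation L := (Lambda k).
Local Notation g := (Lgen k).
Local Notation der := (der0 (@Lgrading k)).
Hypothesis two_neq0 : 2%:R != 0 :> k.

Lemma der_genE (D : der) : [/\
  forall j, D (g (Vpos j)) = \sum_i der_mx Vpos D i j *: g (Vpos i),
  forall j, D (g (Vneg j)) = \sum_i der_mx Vneg D i j *: g (Vneg i),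
  forall j, D (g (Wpos j)) = \sum_i der_mx Wpos D i j *: g (Wpos i)
& forall j, D (g (Wneg j)) = \sum_i der_mx Wneg D i j *: g (Wneg i)].
Proof.
have Dh a : Lhomog 1 (D (g a)).
  apply: (@der0_homog _ _ (@Lgrading k) D 1).
  by exists (tgen k a) => //; apply: thomog_tbasis.
have z a c : (forall i, ~~ ((src a == src (c i)) && (tgt a == tgt (c i)))) ->
    \sum_(i < 3) Lcoef (c i) (D (g a)) *: g (c i) = 0.
  by move=> h; rewrite big1 // => i _; rewrite Lcoef_der // scale0r.
have mxE c j : \sum_i der_mx c D i j *: g (c i) =
               \sum_i Lcoef (c i) (D (g (c j))) *: g (c i).
  by apply: eq_bigr => i _; rewrite mxE.
split=> j; rewrite mxE [LHS](Lhomog1E (Dh _)) sum_arrow.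
- rewrite (z _ Vneg) => [|i]; last by apply/negP => /andP[/eqP].
  rewrite (z _ Wpos) => [|i]; last by apply/negP => /andP[/eqP].
  rewrite (z _ Wneg) => [|i]; last by apply/negP => /andP[_ /eqP].
  by rewrite !addr0.
- rewrite (z _ Vpos) => [|i]; last by apply/negP => /andP[/eqP].
  rewrite (z _ Wpos) => [|i]; last by apply/negP => /andP[/eqP].
  rewrite (z _ Wneg) => [|i]; last by apply/negP => /andP[/eqP].
  by rewrite !addr0 add0r.
- rewrite (z _ Vneg) => [|i]; last by apply/negP => /andP[/eqP].
  rewrite (z _ Vpos) => [|i]; last by apply/negP => /andP[/eqP].
  rewrite (z _ Wneg) => [|i]; last by apply/negP => /andP[/eqP].
  by rewrite !addr0 add0r.
- rewrite (z _ Vneg) => [|i]; last by apply/negP => /andP[/eqP].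
  rewrite (z _ Wpos) => [|i]; last by apply/negP => /andP[/eqP].
  rewrite (z _ Vpos) => [|i]; last by apply/negP => /andP[_ /eqP].
  by rewrite !add0r.
Qed.

Lemma functional_mull (A : algType k) (psi : {linear A -> k^o}) (c : 'I_3 -> k) F y :
  psi ((\sum_i c i *: F i) * y) = \sum_i c i * psi (F i * y).
Proof.
rewrite lincomb_mull linear_sum; apply: eq_bigr => i _.
by rewrite linearZ.
Qed.

Lemma functional_mulr (A : algType k) (psi : {linear A -> k^o}) (c : 'I_3 -> k) F y :
  psi (y * (\sum_i c i *: F i)) = \sum_i c i * psi (y * F i).
Proof.
rewrite lincomb_mulr linear_sum; apply: eq_bigr => i _.
by rewrite linearZ.
Qed.

Lemma sum_pick (c f : 'I_3 -> k) j b :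
  (forall i, f i = (i == j)%:R * b) -> \sum_i c i * f i = c j * b.
Proof.
move=> h; rewrite (bigD1 j) //= big1 => [|i /negPf ij].
  by rewrite addr0 h eqxx mul1r.
by rewrite h ij mul0r mulr0.
Qed.

Lemma functional_der (psi : {linear L -> k^o}) (D : der) (b c : 'I_3 -> arrow)
  (B C : 'M[k]_3) i j :
  (forall j, D (g (b j)) = \sum_i B i j *: g (b i)) ->
  (forall j, D (g (c j)) = \sum_i C i j *: g (c i)) ->
  psi (D (g (b i) * g (c j))) = \sum_l B l i * psi (g (b l) * g (c j))
    + \sum_l C l j * psi (g (b i) * g (c l)).
Proof. by move=> hb hc; rewrite der0M hb hc linearD functional_mull functional_mulr. Qed.

Lemma der_mx_dual_v (D : der) : exists t, forall i j,
  der_mx Vneg D j i + der_mx Vpos D i j = (i == j)%:R * t.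
Proof.
have [e1 e2 _ _] := der_genE D; have [psi h] := functional_vnvp k.
exists (psi (D (g (Vneg 0) * g (Vpos 0)))) => i j.
transitivity (psi (D (g (Vneg i) * g (Vpos j)))); last by rewrite vnvpE derZ linearZ.
rewrite (functional_der psi i j e2 e1).
rewrite (@sum_pick _ _ j 1) => [|l]; last by rewrite h mulr1.
rewrite (@sum_pick _ _ i 1) => [|l]; last by rewrite h mulr1 eq_sym.
by rewrite !mulr1.
Qed.

Lemma der_mx_dual_w (D : der) : exists t, forall i j,
  der_mx Wpos D j i + der_mx Wneg D i j = (i == j)%:R * t.
Proof.
have [_ _ e1 e2] := der_genE D; have [psi h] := functional_wpwn k.
exists (psi (D (g (Wpos 0) * g (Wneg 0)))) => i j.
transitivity (psi (D (g (Wpos i) * g (Wneg j)))); last by rewrite wpwnE derZ linearZ.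
rewrite (functional_der psi i j e1 e2).
rewrite (@sum_pick _ _ j 1) => [|l]; last by rewrite h mulr1.
rewrite (@sum_pick _ _ i 1) => [|l]; last by rewrite h mulr1 eq_sym.
by rewrite !mulr1.
Qed.

(** The relation with [i = j = q] gives the first claim, up to the factor [2];
    the one with [i = p], [j = q] gives the second. *)
Lemma der_mx_wv (D : der) p q : p != q ->
  der_mx Vpos D p q = der_mx Wpos D p q /\
  der_mx Vpos D q q - der_mx Wpos D q q = der_mx Vpos D p p - der_mx Wpos D p p.
Proof.
move=> pq; have [e1 _ e3 _] := der_genE D; have [psi h] := functional_wpvp k p q.
have ev i j : psi (D (g (Wpos i) * g (Vpos j))) =
    der_mx Wpos D p i * (j == q)%:R - der_mx Wpos D q i * (j == p)%:R +
    (der_mx Vpos D q j * (i == p)%:R - der_mx Vpos D p j * (i == q)%:R).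
  rewrite (functional_der psi i j e3 e1); congr (_ + _).
    under eq_bigr do rewrite h mulrBr.
    rewrite sumrB; congr (_ - _); apply: sum_pick => l; rewrite -natrM mulnb //.
  under eq_bigr do rewrite h mulrBr.
  by rewrite sumrB; congr (_ - _); apply: sum_pick => l; rewrite -natrM mulnb andbC.
have D0 i j : psi (D (g (Wpos i) * g (Vpos j))) + psi (D (g (Wpos j) * g (Vpos i))) = 0.
  by rewrite -linearD -(linearD D) wpvpE !linear0.
have qp : (q == p) = false by rewrite eq_sym (negPf pq).
split.
  have := D0 q q; rewrite ev !eqxx qp !mulr0 !mulr1 subr0 sub0r => /eqP.
  rewrite -mulr2n -mulr_natl mulf_eq0 (negPf two_neq0) /= subr_eq0 => /eqP ->.
  by [].
have := D0 p q; rewrite !ev !eqxx qp (negPf pq) !mulr0 !mulr1 !subr0 !sub0r.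
move=> h0; apply/eqP; rewrite -subr_eq0 -h0; apply/eqP; ring.
Qed.

Lemma der_mx_vvww (D : der) p q : p != q ->
  der_mx Vpos D p p + der_mx Vneg D q q = der_mx Wpos D p p + der_mx Wneg D q q.
Proof.
move=> pq; have [e1 e2 e3 e4] := der_genE D; have [psi [h h']] := functional_vpvn k p q.
have D0 : psi (D (g (Vpos p) * g (Vneg q))) + psi (D (g (Wneg q) * g (Wpos p))) = 0.
  by rewrite -linearD -(linearD D) vpvnE (negPf pq) scale0r !linear0.
move: D0; rewrite (functional_der psi p q e1 e2) (functional_der psi q p e4 e3).
rewrite (@sum_pick _ _ p 1) => [|l]; last by rewrite h eqxx andbT mulr1.
rewrite (@sum_pick _ _ q 1) => [|l]; last by rewrite h eqxx mulr1.
rewrite (@sum_pick _ _ q (-1)) => [|l]; last by rewrite h' eqxx mulrN1.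
rewrite (@sum_pick _ _ p (-1)) => [|l]; last by rewrite h' eqxx andbT mulrN1.
rewrite !mulr1 !mulrN1 -opprD => /eqP; rewrite subr_eq0 => /eqP ->.
exact: addrC.
Qed.

(** For a sum of the derivation of a matrix and [c] times the grading derivation
    this is [2 c]: it is the factor by which [D] scales the products
    [Vneg i Vpos i]. *)
Definition der_weight (D : der) : k := der_mx Vpos D 0 0 + der_mx Vneg D 0 0.

(** The four matrices depend only on the two matrices on [Vpos] and [Wpos], which
    differ by a scalar, and on one scalar. That the scalars for [v] and [w]
    agree is forced by the relations that mix the two. *)
Lemma der_structure (D : der) : [/\
  der_mx Vneg D = (der_weight D)%:M - (der_mx Vpos D)^T,
  der_mx Wneg D = (der_weight D)%:M - (der_mx Wpos D)^T
& exists m, der_mx Vpos D = der_mx Wpos D + m%:M].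
Proof.
have [t ht] := der_mx_dual_v D; have [t' ht'] := der_mx_dual_w D.
have tE : t = der_weight D.
  by rewrite /der_weight addrC ht eqxx mul1r.
have d : exists m, der_mx Vpos D = der_mx Wpos D + m%:M.
  exists (der_mx Vpos D 0 0 - der_mx Wpos D 0 0); apply/matrixP => i j.
  rewrite [RHS]mxE [X in _ + X]mxE; have [<-{j}|ij] := eqVneq i j.
    rewrite mulr1n; have [->|i0] := eqVneq i 0; first by rewrite addrC subrK.
    by have [_ ->] := der_mx_wv D i0; rewrite addrC subrK.
  by rewrite mulr0n addr0; have [] := der_mx_wv D ij.
have t't : t' = t.
  have p01 : (0 : 'I_3) != 1 by [].
  have := der_mx_vvww D p01; have := der_mx_wv D p01.
  have := ht 1 1; have := ht' 1 1; rewrite !eqxx !mul1r => <- <- [_ e] e'.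
  apply/eqP; rewrite -subr_eq0; apply/eqP; move: e e'.
  set a := der_mx Vpos D 1 1; set a' := der_mx Wpos D 1 1.
  set b := der_mx Vpos D 0 0; set b' := der_mx Wpos D 0 0 => e e'.
  have -> : a = b - b' + a' by rewrite -e subrK.
  have -> : b = b' + der_mx Wneg D 1 1 - der_mx Vneg D 1 1 by rewrite -e' addrK.
  ring.
have sub (A B : 'M[k]_3) : (forall i j, B j i + A i j = (i == j)%:R * t) ->
    B = (der_weight D)%:M - A^T.
  move=> h; apply/matrixP => i j; rewrite [RHS]mxE [X in _ = X + _]mxE.
  rewrite [X in _ = _ + X]mxE [X in _ = _ - X]mxE -tE -mulr_natl eq_sym -h.
  by rewrite addrK.
split=> //; first exact: sub.
by apply: sub => i j; rewrite -t't eq_sym -ht' addrC.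
Qed.

End Structure.

(** * Inner derivations *)
Section InnerDerivations.
Variable k : fieldType.
Local Notation T := (tensor_alg k).
Local Notation L := (Lambda k).
Local Notation g := (Lgen k).
Local Notation der := (der0 (@Lgrading k)).

Lemma tmul_tgen_coef (t : T) b c :
  (t * tgen k c)@_(parrow b) = t@_(ptriv (src c)) * (c == b)%:R.
Proof.
elim/tensor_ind: t => [|f h hf hh|a x]; first by rewrite mul0r !mcoeff0 mul0r.
  by rewrite mulrDl !mcoeffD hf hh mulrDl.
rewrite -scalerAl !mcoeffZ -mulrA; congr (_ * _); rewrite tbasis_coef tbasisM.
case: pcompP => [z ez sz _ az|nz] /=; last first.
  rewrite mcoeff0; case: eqP => [xc|_]; last by rewrite mul0r.
  by case: nz; rewrite xc.
rewrite tbasis_coef -natrM mulnb; congr (nat_of_bool _)%:R.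
apply/eqP/andP => [zb|[/eqP xc /eqP <-]]; last first.
  by apply: qpathP; rewrite ?sz ?az xc.
move: az; rewrite zb /=; case xs: (parrows x) => [|d s] /=; last first.
  by case=> _; case: s {xs}.
case=> ->; split=> //; apply/eqP; apply: qpathP; last by rewrite xs.
by rewrite -[LHS]/(endpoint (pstart x) [::]) -xs -/(pend x) ez.
Qed.

Lemma tgen_tmul_coef (t : T) b c :
  (tgen k c * t)@_(parrow b) = t@_(ptriv (tgt c)) * (c == b)%:R.
Proof.
elim/tensor_ind: t => [|f h hf hh|a x]; first by rewrite mulr0 !mcoeff0 mul0r.
  by rewrite mulrDr !mcoeffD hf hh mulrDl.
rewrite -scalerAr !mcoeffZ -mulrA; congr (_ * _); rewrite tbasis_coef tbasisM.
case: pcompP => [z ez sz _ az|nz] /=; last first.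
  rewrite mcoeff0; case: eqP => [xc|_]; last by rewrite mul0r.
  by case: nz; rewrite xc.
rewrite tbasis_coef -natrM mulnb; congr (nat_of_bool _)%:R.
apply/eqP/andP => [zb|[/eqP xc /eqP <-]]; last first.
  by apply: qpathP; rewrite ?sz ?az ?xc.
move: az; rewrite zb /= => -[-> /esym xs]; split=> //; apply/eqP.
by apply: qpathP; rewrite ?xs // -ez.
Qed.

(** Only the coefficients of the element at the trivial paths contribute to the
    linear part of the commutator with a generator. *)
Lemma inner_der_mx (D : der) : is_inner D ->
  exists s, der_mx Vpos D = s%:M /\ der_mx Vneg D = - s%:M.
Proof.
case=> a Da; pose al u := (Lrepr a)@_(ptriv u).
exists (al pt_lambda - al pt_gamma).
have coefE b c : Lcoef b (D (g c)) = (al (src c) - al (tgt c)) * (c == b)%:R.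
  rewrite Da linearB /= -[a]LreprK /Lgen -!LprojM !LcoefE.
  by rewrite tmul_tgen_coef tgen_tmul_coef mulrBl.
split; apply/matrixP => i j; rewrite [LHS]mxE coefE.
  rewrite mxE -[RHS]mulr_natr; congr (_ * (nat_of_bool _)%:R).
  by apply/eqP/eqP => [[]|->].
rewrite [RHS]mxE mxE -[X in _ = - X]mulr_natr -mulNr opprB.
by congr (_ * (nat_of_bool _)%:R); apply/eqP/eqP => [[]|->].
Qed.

Lemma diagonal_inner (al : vertex -> k) : exists D : der, [/\ is_inner D,
  forall u, D (Lidem k u) = 0 & forall a, D (g a) = (al (src a) - al (tgt a)) *: g a].
Proof.
pose s := \sum_u al u *: tidem k u; pose a := Lproj s.
have sh : thomog 0 s by apply: thomog_sum => u _; apply/thomogZ/thomog_tbasis.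
have aE : a = \sum_u al u *: Lidem k u.
  by rewrite /a [LHS]linear_sum; apply: eq_bigr => u _; exact: LprojZ.
have ad_der : (fun x => a * x - x * a) \in der0_pred (@Lgrading k).
  apply/der0_predP; split=> [c x y|x y|n x [t ht ->]].
  - by rewrite mulrDr mulrDl -scalerAr -scalerAl scalerBr opprD addrACA.
  - by rewrite mulrBl mulrBr !mulrA addrA subrK.
  exists (s * t - t * s); last by rewrite -!LprojM -!scaleN1r -LprojZ -LprojD.
  apply: thomogD; first exact: (@thomogM _ 0).
  rewrite -scaleN1r; apply: thomogZ; rewrite -[n]addn0; exact: thomogM.
exists (Der0 ad_der); split=> [|u|c]; first by exists a.
- have ea : a * Lidem k u = al u *: Lidem k u.
    rewrite aE mulr_suml (bigD1 u) //= -scalerAl idem_idem eqxx scale1r.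
    rewrite big1 ?addr0 // => v /negPf vu.
    by rewrite -scalerAl idem_idem vu scale0r scaler0.
  have ae : Lidem k u * a = al u *: Lidem k u.
    rewrite aE mulr_sumr (bigD1 u) //= -scalerAr idem_idem eqxx scale1r.
    rewrite big1 ?addr0 // => v vu.
    by rewrite -scalerAr idem_idem eq_sym (negPf vu) scale0r scaler0.
  by rewrite -[LHS]/(a * Lidem k u - Lidem k u * a) ea ae subrr.
- have ea : a * g c = al (src c) *: g c.
    rewrite aE mulr_suml (bigD1 (src c)) //= -scalerAl idem_gen eqxx scale1r.
    rewrite big1 ?addr0 // => v /negPf vu.
    by rewrite -scalerAl idem_gen vu scale0r scaler0.
  have ae : g c * a = al (tgt c) *: g c.
    rewrite aE mulr_sumr (bigD1 (tgt c)) //= -scalerAr gen_idem eqxx scale1r.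
    rewrite big1 ?addr0 // => v /negPf vu.
    by rewrite -scalerAr gen_idem vu scale0r scaler0.
  by rewrite -[LHS]/(a * g c - g c * a) ea ae scalerBl.
Qed.

Hypothesis two_neq0 : 2%:R != 0 :> k.

(** By [der_structure] the derivation multiplies the four families by [s],
    [- s], [s - m] and [- (s - m)]. These are the commutators with a
    combination of the idempotents. *)
Lemma scalar_der_inner (D : der) s :
  der_mx Vpos D = s%:M -> der_weight D = 0 -> is_inner D.
Proof.
move=> Ds w0; have [] := der_structure two_neq0 D.
rewrite Ds w0 raddf0 !sub0r tr_scalar_mx => DV DWn [m].
move/eqP; rewrite -subr_eq -raddfB => /eqP/esym DW.
pose al u := match u with
  pt_lambda => 0 | pt_gamma => - s | pt_mu => s - m end.
have [E [Ei E0 Eg]] := diagonal_inner al.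
have sc (F : 'I_3 -> L) c j : \sum_i (c%:M : 'M[k]_3) i j *: F i = c *: F j.
  rewrite (bigD1 j) //= mxE eqxx mulr1n big1 ?addr0 // => i /negPf ij.
  by rewrite mxE ij mulr0n scale0r.
have [e1 e2 e3 e4] := der_genE two_neq0 D.
rewrite Ds in e1; rewrite DV -raddfN in e2; rewrite DW in e3.
rewrite DWn DW tr_scalar_mx -raddfN in e4.
have -> // : D = E.
apply: der_eq => [u|[] i]; first by rewrite E0 der_idem.
- by rewrite e1 sc Eg /= sub0r opprK.
- by rewrite e2 sc Eg /= subr0.
- by rewrite e3 sc Eg /= subr0.
- by rewrite e4 sc Eg /= sub0r.
Qed.

End InnerDerivations.

(** * The isomorphism with gl_3 *)
Section Isomorphism.
Variable k : fieldType.
Local Notation L := (Lambda k).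
Local Notation g := (Lgen k).
Local Notation der := (der0 (@Lgrading k)).
Local Notation HH := (HH1_0 (@Lgrading k)).
Hypothesis two_neq0 : 2%:R != 0 :> k.
Hypothesis three_neq0 : 3%:R != 0 :> k.

Lemma der_mx_lie c (D E : der) :
  (forall j, D (g (c j)) = \sum_i der_mx c D i j *: g (c i)) ->
  (forall j, E (g (c j)) = \sum_i der_mx c E i j *: g (c i)) ->
  der_mx c (lie D E) = der_mx c D *m der_mx c E - der_mx c E *m der_mx c D.
Proof.
have half (F G : der) i j : 
    (forall j, G (g (c j)) = \sum_i der_mx c G i j *: g (c i)) ->
    Lcoef (c i) (F (G (g (c j)))) = (der_mx c F *m der_mx c G) i j.
  move=> hG; rewrite hG der_sum linear_sum mxE; apply: eq_bigr => l _.
  rewrite derZ linearZ mulrC; congr (_ * _); by rewrite [RHS]mxE.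
move=> hD hE; apply/matrixP => i j; rewrite [LHS]mxE.
rewrite -[X in Lcoef _ X]/(D (E (g (c j))) - E (D (g (c j)))) linearB /=.
by rewrite !half // [RHS]mxE [X in _ = _ + X]mxE.
Qed.

Lemma der_weight_is_linear : linear (@der_weight k : der -> k^o).
Proof.
move=> a D E; rewrite /der_weight !linearP !mxE -!/(der_mx _ _ _ _).
by rewrite scalerDr addrACA.
Qed.

HB.instance Definition _ :=
  GRing.isLinear.Build k der k^o _ (@der_weight k) der_weight_is_linear.

(** The matrices on [Vpos] and [Vneg] are [A] and [t - A^T], so their
    commutators are opposite transposes of each other. *)
Lemma der_weight_lie (D E : der) : der_weight (lie D E) = 0.
Proof.
have [d1 d2 _ _] := der_genE two_neq0 D; have [e1 e2 _ _] := der_genE two_neq0 E.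
rewrite /der_weight (der_mx_lie d1 e1) (der_mx_lie d2 e2).
have [-> _ _] := der_structure two_neq0 D; have [-> _ _] := der_structure two_neq0 E.
rewrite !mulmxBl !mulmxBr -!trmx_mul !mul_scalar_mx !mul_mx_scalar.
rewrite scale_scalar_mx scale_scalar_mx mulrC !mxE.
ring.
Qed.

Definition traceless (A : 'M[k]_3) : 'M[k]_3 := A - (\tr A / 3%:R)%:M.

Lemma tr_traceless A : \tr (traceless A) = 0.
Proof. by rewrite /traceless raddfB /= mxtrace_scalar -[X in _ - X]mulr_natr divfK ?subrr. Qed.

(** The traceless part of the matrix on [Vpos] is unchanged by inner
    derivations; its trace is not, and the weight takes its place. *)
Definition der_gl (D : der) : gl k 3 :=
  traceless (der_mx Vpos D) + (der_weight D)%:M.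

Lemma traceless_is_linear : linear traceless.
Proof.
move=> a A B; rewrite /traceless linearP /= mulrDl -mulrA raddfD /=.
by rewrite -scale_scalar_mx scalerBr opprD addrACA.
Qed.

Lemma der_gl_is_linear : linear der_gl.
Proof.
move=> a D E; rewrite /der_gl (der_mx_is_linear Vpos) traceless_is_linear.
rewrite [der_weight _]der_weight_is_linear.
have -> (c d : k) : (a *: (c : k^o) + d)%:M = a *: c%:M + d%:M :> 'M[k]_3.
  by rewrite scale_scalar_mx raddfD.
by rewrite addrACA -scalerDr.
Qed.

HB.instance Definition _ :=
  GRing.isLinear.Build k der (gl k 3) _ der_gl der_gl_is_linear.

Lemma der_gl_inner (D : der) : is_inner D -> der_gl D = 0.
Proof.
case/inner_der_mx => s [e1 e2].
rewrite /der_gl /traceless /der_weight e1 e2 mxtrace_scalar -[s *+ 3]mulr_natr mulfK //.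
by rewrite subrr add0r !mxE addrN raddf0.
Qed.

Lemma der_gl_ker (D : der) : der_gl D = 0 -> is_inner D.
Proof.
move=> h; have w0 : der_weight D = 0.
  have := congr1 mxtrace h; rewrite /der_gl mxtraceD tr_traceless add0r.
  rewrite mxtrace0 mxtrace_scalar -mulr_natr => /eqP.
  by rewrite mulf_eq0 (negPf three_neq0) orbF => /eqP.
move: h; rewrite /der_gl w0 raddf0 addr0 => /eqP; rewrite subr_eq0 => /eqP h.
exact: (scalar_der_inner two_neq0 h w0).
Qed.

Lemma der_gl_lie (D E : der) : der_gl (lie D E) = lie (der_gl D) (der_gl E).
Proof.
have [d1 _ _ _] := der_genE two_neq0 D; have [e1 _ _ _] := der_genE two_neq0 E.
rewrite {1}/der_gl der_weight_lie raddf0 addr0 (der_mx_lie d1 e1) /traceless.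
rewrite raddfB /= mxtrace_mulC subrr mul0r raddf0 subr0.
rewrite -[RHS]/(der_gl D *m der_gl E - der_gl E *m der_gl D).
have cen (A B : 'M[k]_3) c d : (A + c%:M) *m (B + d%:M) - (B + d%:M) *m (A + c%:M) =
    A *m B - B *m A.
  rewrite !mulmxDl !mulmxDr !mul_scalar_mx !mul_mx_scalar !scale_scalar_mx.
  rewrite [d * c]mulrC !opprD !addrA.
  by rewrite (ACl ((1*5)*(2*7)*(3*6)*(4*8))) /= !subrr !addr0.
have e (F : der) : der_gl F = der_mx Vpos F +
    (der_weight F - \tr (der_mx Vpos F) / 3%:R)%:M.
  by rewrite /der_gl /traceless raddfB /= -addrA [X in _ + X]addrC.
by rewrite (e D) (e E) cen.
Qed.

Definition HH_gl (x : HH) : gl k 3 := der_gl (HH1_repr x).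

Lemma HH_glE D : HH_gl (HH1_class D) = der_gl D.
Proof.
apply/eqP; rewrite -subr_eq0 -linearB; apply/eqP/der_gl_inner.
by apply/HH1_classP; rewrite HH1_reprK.
Qed.

Lemma HH_gl_is_linear : linear HH_gl.
Proof.
by move=> a x y; rewrite -[x]HH1_reprK -[y]HH1_reprK -linearP !HH_glE linearP.
Qed.

HB.instance Definition _ :=
  GRing.isLinear.Build k HH (gl k 3) _ HH_gl HH_gl_is_linear.

Lemma HH_gl_lie : lie_morphism HH_gl.
Proof.
move=> x y; rewrite -[x]HH1_reprK -[y]HH1_reprK.
by rewrite -[lie _ _]/(HH1_lie _ _) HH1_lieE !HH_glE der_gl_lie.
Qed.

Lemma HH_gl_inj : injective HH_gl.
Proof.
move=> x y e; rewrite -[x]HH1_reprK -[y]HH1_reprK; apply/HH1_classP.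
apply: der_gl_ker; rewrite linearB; apply/eqP; rewrite subr_eq0; apply/eqP.
exact: e.
Qed.

Lemma is_gl_der_mx X (D : der) : is_gl_der X D -> der_gl D = traceless X.
Proof.
case=> _ h1 h1' _ _.
have e1 : der_mx Vpos D = X.
  apply/matrixP => i j; rewrite mxE h1 linear_sum (bigD1 i) //= big1 => [|l /negPf li].
    by rewrite addr0 linearZ /= Lcoef_gen eqxx; exact: mulr1.
  rewrite linearZ /= Lcoef_gen; case: eqP => [[e]|_]; last exact: mulr0.
  by rewrite e eqxx in li.
have e2 : der_mx Vneg D = - X^T.
  apply/matrixP => i j; rewrite !mxE h1' linear_sum (bigD1 i) //= big1 => [|l /negPf li].
    by rewrite addr0 linearZ /= Lcoef_gen eqxx; exact: mulr1.
  rewrite linearZ /= Lcoef_gen; case: eqP => [[e]|_]; last exact: mulr0.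
  by rewrite e eqxx in li.
by rewrite /der_gl /der_weight e1 e2 !mxE addrN raddf0 addr0.
Qed.

Lemma grading_der_gl (D : der) : (forall a, D (g a) = g a) -> der_gl D = 2%:R%:M.
Proof.
move=> h.
have e c : injective c -> der_mx c D = 1%:M.
  move=> ci; apply/matrixP => i j; rewrite !mxE h Lcoef_gen.
  by rewrite (inj_eq ci) eq_sym.
rewrite /der_gl /der_weight !e => [|? ? []|? ? []] //.
rewrite /traceless mxtrace_scalar divff // subrr add0r !mxE eqxx.
by rewrite -natrD.
Qed.

Lemma traceless_id (A : 'M[k]_3) : \tr A = 0 -> traceless A = A.
Proof. by move=> h; rewrite /traceless h mul0r raddf0 subr0. Qed.

Section Surjectivity.
Variables (Delta : der) (rho : 'M[k]_3 -> der).
Hypothesis Delta_gen : forall a, Delta (g a) = g a.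
Hypothesis rho_gl : forall X, is_gl_der X (rho X).

(** The grading derivation is sent to the scalar matrix [2], so
    the scalar part [tr A / 3] requires the coefficient [tr A / 6]. *)
Definition gl_HH (A : gl k 3) : HH :=
  HH1_class (rho (traceless A)) + (\tr A / 6%:R) *: HH1_class Delta.

Lemma gl_HHK : cancel gl_HH HH_gl.
Proof.
move=> A; rewrite /gl_HH linearD linearZ /= !HH_glE (is_gl_der_mx (rho_gl _)).
rewrite traceless_id ?tr_traceless // (grading_der_gl Delta_gen).
rewrite [_ *: _]scale_scalar_mx.
have -> : \tr A / 6%:R * 2%:R = \tr A / 3%:R.
  by rewrite (natrM k 3 2) invfM mulrA mulfVK.
exact: subrK.
Qed.

Lemma HH_glK : cancel HH_gl gl_HH.
Proof. by move=> x; apply: HH_gl_inj; rewrite gl_HHK. Qed.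

End Surjectivity.

Lemma HH1_0_lie_isomorphic_gl : lie_isomorphic HH (gl k 3).
Proof.
have [Delta [_ _ Dg]] := grading_der k.
pose rho (X : 'M[k]_3) := projT1 (cid (gl_der_exists X)).
have rhoP X : is_gl_der X (rho X) by exact: projT2 (cid (gl_der_exists X)).
exists HH_gl; split; last exact: HH_gl_lie.
by exists (gl_HH Delta rho); [apply: HH_glK|apply: gl_HHK].
Qed.

(** Conjugation by [diag(1, -1, 1)], the change of basis between the
    generators and their signed versions. *)
Definition sign_conj (X : 'M[k]_3) : 'M[k]_3 :=
  \matrix_(i, j) ((-1) ^+ i * X i j * (-1) ^+ j).

Lemma sign_conjK : involutive sign_conj.
Proof.
move=> X; apply/matrixP => i j; rewrite !mxE.
by rewrite !mulrA -expr2 sqrr_sign mul1r -mulrA -expr2 sqrr_sign mulr1.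
Qed.

Lemma tr_sign_conj X : \tr (sign_conj X) = \tr X.
Proof.
apply: eq_bigr => i _; rewrite mxE mulrAC -expr2 sqrr_sign; exact: mul1r.
Qed.

Lemma gl_der_sgen X D : is_gl_der (sign_conj X) D -> is_sl3_der X D.
Proof.
have sE (F : 'I_3 -> L) (c : 'I_3 -> k) j :
    (forall i, c i = (-1) ^+ i * X i j * (-1) ^+ j) ->
    (-1) ^+ j *: (\sum_i c i *: F i) = \sum_i X i j *: ((-1) ^+ i *: F i).
  move=> h; rewrite scaler_sumr; apply: eq_bigr => i _; rewrite !scalerA h.
  by congr (_ *: _); rewrite mulrC -!mulrA -expr2 sqrr_sign mulr1 mulrC.
have sE' (F : 'I_3 -> L) (c : 'I_3 -> k) (j : 'I_3) :
    (forall i, c i = (-1) ^+ j * X j i * (-1) ^+ i) ->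
    (-1) ^+ j *: (\sum_i - c i *: F i) = - \sum_i X j i *: ((-1) ^+ i *: F i).
  move=> h; rewrite scaler_sumr -sumrN; apply: eq_bigr => i _.
  rewrite !scalerA h -scaleNr; congr (_ *: _).
  by rewrite mulrN !mulrA -expr2 sqrr_sign mul1r.
case=> D0 D1 D2 D3 D4; split=> // j; rewrite /sgen derZ.
- by rewrite D1; apply: sE => i; rewrite mxE.
- by rewrite D2; apply: sE' => i; rewrite mxE.
- by rewrite D3; apply: sE => i; rewrite mxE.
- by rewrite D4; apply: sE' => i; rewrite mxE.
Qed.

Lemma HH1_0_spanned : exists (Delta : der) (rho : 'M[k]_3 -> der),
  [/\ is_grading_der Delta,
      forall X : 'M[k]_3, \tr X = 0 -> is_sl3_der X (rho X)
    & spans (fun h : HH => h = HH1_class Delta \/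
        exists2 X : 'M[k]_3, \tr X = 0 & h = HH1_class (rho X))].
Proof.
have [Delta [Dgr _ Dg]] := grading_der k.
pose rho (X : 'M[k]_3) := projT1 (cid (gl_der_exists X)).
have rhoP X : is_gl_der X (rho X) by exact: projT2 (cid (gl_der_exists X)).
exists Delta, (rho \o sign_conj); split=> // [X _|x].
  by apply: gl_der_sgen; apply: rhoP.
pose A := HH_gl x.
exists [:: (1, HH1_class (rho (traceless A))); (\tr A / 6%:R, HH1_class Delta)].
  move=> c; rewrite !inE => /orP[] /eqP -> /=; last by left.
  right; exists (sign_conj (traceless A)); first by rewrite tr_sign_conj tr_traceless.
  by rewrite sign_conjK.
rewrite !big_cons big_nil addr0 /= scale1r; exact/esym/(HH_glK Dg rhoP).
Qed.

End Isomorphism.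

Theorem proposition6p2 (k : closedFieldType) (p : nat)
    (hp : p \in [pchar k]) (hp3 : (3 < p)%N) :
  lie_isomorphic (HH1_0 (@Lgrading k)) (gl k 3) /\
  exists (Delta : der0 (@Lgrading k)) (rho : 'M[k]_3 -> der0 (@Lgrading k)),
    [/\ is_grading_der Delta,
        forall X : 'M[k]_3, \tr X = 0 -> is_sl3_der X (rho X)
      & spans (fun h : HH1_0 (@Lgrading k) =>
          h = HH1_class Delta \/
          exists2 X : 'M[k]_3, \tr X = 0 & h = HH1_class (rho X))].
Proof.
have nz n : (0 < n < 4)%N -> n%:R != 0 :> k.
  case/andP=> n0 n4; rewrite -(dvdn_pcharf hp) gtnNdvd //.
  exact: leq_trans n4 _.
split; first by apply: HH1_0_lie_isomorphic_gl; apply: nz.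
by apply: HH1_0_spanned; apply: nz.
Qed.
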